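(* Let $R$ be a regular local ring with maximal ideal $\mathfrak m$, residue field $\mathbb{K}=R/\mathfrak m$ and $\mathfrak m$-adic completion $\widehat R$, and fix a regular system of parameters $(x_1,\dots,x_n)$ of $R$. Let $f\in R$ be nonzero and assume that the Newton polyhedron $\Delta(f)$ has a loose edge $E$. If $f|_E=GH$ for two relatively prime polynomials $G,H\in\mathbb{K}[X_1,\dots,X_n]$, where $G$ is not divisible by any variable $X_i$, then there exist $g,h\in\widehat R$ such that $f=gh$ in $\widehat R$, and compact faces $E_1$ of $\Delta(g)$ and $E_2$ of $\Delta(h)$ such that $E=E_1+E_2$ (Minkowski sum), $g|_{E_1}=G$ and $h|_{E_2}=H$.
   Context: Every element $f$ of $R$ (and likewise of $\widehat R$, with the regular system of parameters $(x_1,\dots,x_n)$) can be written as a finite sum $f=\sum_{\alpha\in\mathbb{Z}_{\ge0}^n}a_\alpha\underline x^\alpha$ with $a_\alpha\in R^\times\cup\{0\}$, where $\underline x^\alpha=x_1^{\alpha_1}\cdots x_n^{\alpha_n}$. The Newton polyhedron $\Delta(f)$ of nonzero $f$ is the convex hull of $\{\alpha: a_\alpha\neq0\}+\mathbb{R}_{\ge0}^n$. For $\xi\in\mathbb{R}^n_{\ge0}$, the face $\Delta^\xi$ is $\{a\in\Delta:\langle\xi,a\rangle=\min_{b\in\Delta}\langle\xi,b\rangle\}$; it is compact iff $\xi\in\mathbb{R}^n_{>0}$. An edge is a face of dimension 1; a loose edge is a compact edge not contained in any compact face of dimension $\ge2$. For a compact face $A$ of $\Delta(f)$, the symbolic restriction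 is $f|_A=\sum_{\alpha\in A}\overline{a_\alpha}\,\underline X^\alpha\in\mathbb{K}[X_1,\dots,X_n]$, where $\overline{a_\alpha}$ is the image of $a_\alpha$ in $\mathbb{K}$. *)

(* Defs.v *)
From HB Require Import structures.
From mathcomp Require Import all_boot all_order all_algebra.
From mathcomp Require Import boolp reals.
From mathcomp Require Import mpoly.

Set Implicit Arguments.
Unset Strict Implicit.
Unset Printing Implicit Defensive.

Import Order.TTheory GRing.Theory Num.Theory.
Local Open Scope ring_scope.

Section CommAlg.
Variable R : comUnitRingType.

Definition is_ideal (I : R -> Prop) : Prop :=
  [/\ I 0, (forall a b, I a -> I b -> I (a + b)) & (forall r a, I a -> I (r * a))].

Definition span (S : R -> Prop) (y : R) : Prop :=
  exists k (r s : 'I_k -> R), (forall i, S (s i)) /\ y = \sum_(i < k) r i * s i.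

Definition pow_ideal (I : R -> Prop) (k : nat) : R -> Prop :=
  span (fun z => exists s : 'I_k -> R, (forall i, I (s i)) /\ z = \prod_(i < k) s i).

Definition same_set (A B : R -> Prop) : Prop := forall y, A y <-> B y.

Definition noetherian : Prop :=
  forall I, is_ideal I -> exists k (g : 'I_k -> R), same_set I (span (fun z => exists i, z = g i)).

(* the set of non-units; R is local iff it is an ideal (then the unique maximal ideal) *)
Definition maxid (y : R) : Prop := y \notin GRing.unit.

Definition local_ring : Prop := is_ideal maxid.

Definition prime_ideal (P : R -> Prop) : Prop :=
  [/\ is_ideal P, ~ P 1 & forall a b, P (a * b) -> P a \/ P b].

Definition prime_chain (k : nat) : Prop :=
  exists P : 'I_k.+1 -> (R -> Prop),
    (forall i, prime_ideal (P i)) /\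
    (forall i j : 'I_k.+1, (i < j)%N ->
        (forall y, P i y -> P j y) /\ exists y, P j y /\ ~ P i y).

Definition krull_dim_eq (d : nat) : Prop := prime_chain d /\ ~ prime_chain d.+1.

Definition reg_sys_params n (x : 'I_n -> R) : Prop :=
  krull_dim_eq n /\ same_set maxid (span (fun z => exists i, z = x i)).

Definition regular_local_ring : Prop :=
  [/\ noetherian, local_ring & exists n (x : 'I_n -> R), reg_sys_params x].

End CommAlg.

Definition residue_map (R : comUnitRingType) (K : fieldType) (pi : R -> K) : Prop :=
  (forall k : K, exists r, pi r = k) /\ (forall r, pi r = 0 <-> maxid r).

(* iota : R -> Rhat exhibits Rhat as the m-adic completion of R, i.e.
   Rhat = lim R/m^k :  R/m^k -> Rhat/mhat^k is bijective for every k
   (mhat = m Rhat), and Rhat is mhat-adically separated and complete. *)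
Definition is_completion (R Rhat : comUnitRingType) (iota : R -> Rhat) : Prop :=
  let mh := span (fun z => exists r, maxid r /\ z = iota r) in
  [/\ (forall k (y : Rhat), exists r, pow_ideal mh k (y - iota r)),
      (forall k (r : R), pow_ideal mh k (iota r) -> pow_ideal (@maxid R) k r),
      (forall y : Rhat, (forall k, pow_ideal mh k y) -> y = 0) &
      (forall u : nat -> Rhat, (forall k, pow_ideal mh k (u k.+1 - u k)) ->
          exists y, forall k, pow_ideal mh k (y - u k))].

Definition unit_expansion (R : comUnitRingType) n (x : 'I_n -> R)
    (P : {mpoly R[n]}) (f : R) : Prop :=
  (forall m, P@_m \is a GRing.unit \/ P@_m = 0) /\ f = P.@[x].

Section Polyhedra.
Variables (Rr : realType) (n : nat).
Notation pt := 'rV[Rr]_n.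

Definition mvec (m : 'X_{1..n}) : pt := \row_i ((m i)%:R : Rr).

(* Newton polyhedron: conv{alpha : a_alpha <> 0} + R_{>=0}^n *)
Definition newton (R : ringType) (P : {mpoly R[n]}) (p : pt) : Prop :=
  exists w : 'X_{1..n} -> Rr,
    [/\ forall m, 0 <= w m,
        \sum_(m <- msupp P) w m = 1 &
        forall i, \sum_(m <- msupp P) w m * (mvec m) ord0 i <= p ord0 i].

Definition dotp (xi a : pt) : Rr := \sum_(i < n) xi ord0 i * a ord0 i.

Definition face_at (D : pt -> Prop) (xi : pt) (a : pt) : Prop :=
  D a /\ forall b, D b -> dotp xi a <= dotp xi b.

Definition is_face (D A : pt -> Prop) : Prop :=
  exists xi : pt, (forall i, 0 <= xi ord0 i) /\ forall a, A a <-> face_at D xi a.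

(* compact subset of R^n (faces are closed, so compact = bounded) *)
Definition compact_pts (A : pt -> Prop) : Prop :=
  exists M : Rr, forall a, A a -> forall i, `|a ord0 i| <= M.

Definition dim_ge (A : pt -> Prop) (d : nat) : Prop :=
  exists p : 'I_d.+1 -> pt, (forall j, A (p j)) /\
    row_free (\matrix_(j < d) (p (lift ord0 j) - p ord0)).

Definition is_edge (D E : pt -> Prop) : Prop :=
  is_face D E /\ dim_ge E 1 /\ ~ dim_ge E 2.

Definition loose_edge (D E : pt -> Prop) : Prop :=
  [/\ is_edge D E, compact_pts E &
      forall F, is_face D F -> compact_pts F -> dim_ge F 2 ->
        ~ (forall a, E a -> F a)].

Definition minkowski_eq (E E1 E2 : pt -> Prop) : Prop :=
  forall a, E a <-> exists b c, [/\ E1 b, E2 c & a = b + c].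

Definition sym_restr (R : ringType) (K : fieldType) (pi : R -> K)
    (P : {mpoly R[n]}) (A : pt -> Prop) : {mpoly K[n]} :=
  \sum_(m <- msupp P | `[< A (mvec m) >]) pi P@_m *: 'X_[m].

End Polyhedra.

Definition mdvd (K : fieldType) n (D G : {mpoly K[n]}) : Prop :=
  exists Q, G = D * Q.

Definition rel_prime (K : fieldType) n (G H : {mpoly K[n]}) : Prop :=
  forall D, mdvd D G -> mdvd D H -> D \is a GRing.unit.

(* Main.v *)
Require Import Defs.
From HB Require Import structures.
From mathcomp Require Import all_boot all_order all_algebra.
From mathcomp Require Import boolp reals.
From mathcomp Require Import mpoly.
From mathcomp Require Import zify ring lra.
Import Order.TTheory GRing.Theory Num.Theory.
Local Open Scope ring_scope.

Set Implicit Arguments.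
Unset Strict Implicit.
Unset Printing Implicit Defensive.

(* Write [c = cp - cm] for the primitive direction of the edge [E]. Tilting the
   supporting functional of [E] shows what looseness means: no exponent of [f]
   lies below [E] for any nonnegative weight orthogonal to [c] (a balanced
   weight). The factors [G] and [H] are homogeneous for all balanced weights, so
   up to a monomial they are binary forms in [X^cp] and [X^cm], given by coprime
   polynomials in one variable; since no variable divides [G], its two end
   monomials are pure powers of [X^cp] and [X^cm]. Bezout, and division by these
   end monomials, write every [X^m] with [m] not below [E] as [A G + B H] with
   [A] and [B] homogeneous for all balanced weights. Hensel lifting along a
   positive balanced weight then yields [g] and [h] as convergent series with the
   required exponents, and Dickson's lemma turns the series into finite
   expansions with unit coefficients. *)

(** * Weights and Dickson's lemma *)

(** A single positive balanced weight cannot carry the lifting: a monomial of large weight need not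
    lie in the ideal [(G, H)], for instance a high power of a variable on which [cp] and [cm] both
    vanish when neither [G] nor [H] is constant. The exponents of all successive errors are
    therefore controlled for every balanced weight at once. The set so described is closed upwards,
    so a term whose coefficient has zero residue can be rewritten on larger exponents without
    leaving it, and positivity of the chosen weight makes this rewriting raise the weight. The
    functional that cuts out [E] is real, but the direction of [E] is integral, so balanced weights
    with natural values suffice. Newton polyhedra are read off expansions whose coefficients are
    zero or units. Each coefficient of the two series is therefore set once, at its own weight, as a
    lift of a residue. The passage to finite expansions keeps only minimal exponents; this does not
    disturb the faces, since exponents of least positive weight are minimal. *)

Section Weights.
Variable n : nat.
Implicit Types (w : 'I_n -> nat) (m : 'X_{1..n}).

Definition wt w m := (\sum_i w i * m i)%N.

Lemma wt0 w : wt w 0%MM = 0%N.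
Proof. by rewrite /wt big1 // => i _; rewrite mnm0E muln0. Qed.

Lemma wtD w m1 m2 : wt w (m1 + m2)%MM = (wt w m1 + wt w m2)%N.
Proof. by rewrite /wt -big_split; apply: eq_bigr => i _; rewrite mnmDE mulnDr. Qed.

Lemma wtMn w m k : wt w (m *+ k)%MM = (wt w m * k)%N.
Proof. by rewrite /wt big_distrl; apply: eq_bigr => i _; rewrite mulmnE mulnA. Qed.

Lemma wt_le_mdeg w m : (wt w m <= (\sum_i w i) * mdeg m)%N.
Proof.
rewrite /wt big_distrl /=; apply: leq_sum => i _; rewrite leq_mul2l mdegE.
by rewrite (bigD1 i) //= leq_addr orbT.
Qed.

Lemma mdeg_le_wt w m : (forall i, 0 < w i)%N -> (mdeg m <= wt w m)%N.
Proof. by move=> w_gt0; rewrite mdegE; apply: leq_sum => i _; rewrite leq_pmull. Qed.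

Lemma wt1 m : wt (fun=> 1%N) m = mdeg m.
Proof. by rewrite mdegE; apply: eq_bigr => i _; rewrite mul1n. Qed.

Lemma wt_inj_le w m1 m2 :
  (forall i, 0 < w i)%N -> (m1 <= m2)%MM -> (wt w m2 <= wt w m1)%N -> m1 = m2.
Proof.
move=> w_gt0 le12; rewrite -(submK le12) wtD => le0.
have : (mdeg (m2 - m1)%MM <= 0)%N.
  by apply: leq_trans (mdeg_le_wt _ w_gt0) _; move: le0; lia.
by rewrite leqn0 mdeg_eq0 => /eqP->; rewrite add0m.
Qed.

Lemma dickson (A : 'X_{1..n} -> Prop) :
  exists B : seq 'X_{1..n}, (forall b, b \in B -> A b) /\
    (forall m, A m -> exists2 b, b \in B & (b <= m)%MM).
Proof.
(* induction on the number of coordinates on which members of [A] may differ *)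
suff aux k (I : {set 'I_n}) (A' : 'X_{1..n} -> Prop) : (#|I| <= k)%N ->
    (forall m m', A' m -> A' m' -> forall i, i \notin I -> m i = m' i) ->
  exists B : seq 'X_{1..n}, (forall b, b \in B -> A' b) /\
    (forall m, A' m -> exists2 b, b \in B & (b <= m)%MM).
  by apply: (aux _ setT A (leqnn _)) => m m' _ _ i; rewrite inE.
elim: k I A' => [|k IHk] I A' cardI eqA.
  have [[a0 Aa0]|noA] := pselect (exists a, A' a); last first.
    by exists [::]; split=> // m Am; case: noA; exists m.
  exists [:: a0]; split=> [b|m Am]; first by rewrite inE => /eqP->.
  exists a0; rewrite ?inE //; apply/mnm_lepP => i.
  rewrite (eqA a0 m) //; move: cardI; rewrite leqn0 cards_eq0 => /eqP->.
  by rewrite inE.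
have [[a0 Aa0]|noA] := pselect (exists a, A' a); last first.
  by exists [::]; split=> // m Am; case: noA; exists m.
(* A member not above [a0] takes some value [v < a0 i] at a coordinate [i]. These slices are finite
   in number, and in each of them one coordinate fewer is free. *)
pose A1 (p : 'I_n * nat) m := [/\ p.1 \in I, A' m & m p.1 = p.2].
have covA1 p : exists B : seq 'X_{1..n}, (forall b, b \in B -> A1 p b) /\
    (forall m, A1 p m -> exists2 b, b \in B & (b <= m)%MM).
  have [pI|pNI] := boolP (p.1 \in I); last first.
    by exists [::]; split=> // m [] pI; rewrite pI in pNI.
  apply: (IHk (I :\ p.1)).
    by move: cardI; rewrite (cardsD1 p.1) pI.
  move=> m m' [_ Am em] [_ Am' em'] i; rewrite !inE negb_and negbK.
  by case/orP => [/eqP->|]; [rewrite em em' | exact: eqA].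
have [B BP] := choice covA1.
exists (a0 :: flatten [seq B (i, v) | i <- enum 'I_n, v <- iota 0 (a0 i)]).
split=> [b|m Am].
  rewrite inE => /orP[/eqP->//|/flattenP[s /allpairsPdep[i [v [_ _ ->]]]]].
  by case: (BP (i, v)) => BA _ /BA[].
have [/mnm_lepP le0m|/negP nle0m] := boolP ((a0 <= m)%MM).
  by exists a0; rewrite ?inE ?eqxx //; apply/mnm_lepP.
have [i lt_mi] : exists i, (m i < a0 i)%N.
  apply: contrapT => nlt; apply: nle0m; apply/mnm_lepP => i.
  by rewrite leqNgt; apply/negP => lt_mi; apply: nlt; exists i.
have iI : i \in I by apply/negPn/negP => /(eqA _ _ Am Aa0) e; rewrite e ltnn in lt_mi.
case: (BP (i, m i)) => _ /(_ m) [] // b Bb le_bm; exists b => //.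
rewrite inE; apply/orP; right; apply/flattenP; exists (B (i, m i)) => //.
by apply/allpairsPdep; exists i, (m i); rewrite mem_enum mem_iota.
Qed.

Lemma finitely_many_minimal (A : 'X_{1..n} -> Prop) :
  exists B : seq 'X_{1..n}, [/\ uniq B,
    forall b, b \in B <-> A b /\ (forall m, A m -> (m <= b)%MM -> m = b) &
    forall m, A m -> exists2 b, b \in B & (b <= m)%MM].
Proof.
have [B0 [B0A covB0]] := dickson A.
pose mini b := A b /\ (forall m, A m -> (m <= b)%MM -> m = b).
have memB b : b \in [seq b <- undup B0 | `[< mini b >]] <-> mini b.
  rewrite mem_filter mem_undup; split=> [/andP[/asboolP]//|mb].
  apply/andP; split; first exact/asboolP.
  by case: mb => Ab minb; have [b' B0b' le] := covB0 _ Ab; rewrite -(minb b') //; exact: B0A.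
exists [seq b <- undup B0 | `[< mini b >]]; split=> //.
  by rewrite filter_uniq ?undup_uniq.
move=> m; have [d] := ubnP (mdeg m); elim: d m => // d IHd m lt_md Am.
have [mm|nmm] := pselect (mini m); first by exists m; [exact/memB | exact: lepm_refl].
have [m' [Am' le_m'm ne]] : exists m', [/\ A m', (m' <= m)%MM & m' <> m].
  apply: contrapT => no; apply: nmm; split=> // m' Am' le.
  by apply: contrapT => ne; apply: no; exists m'.
have lt : (mdeg m' < mdeg m)%N.
  rewrite ltnNge; apply/negP => le; apply: ne.
  apply: (@wt_inj_le (fun=> 1%N)) => //.
  by rewrite !wt1.
have [b Bb le_bm'] := IHd m' (leq_trans lt lt_md) Am'.
by exists b => //; apply: lepm_trans le_bm' le_m'm.
Qed.

End Weights.

(** * Factors of homogeneous polynomials *)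

Section HomogeneousFactor.
Variables (K : fieldType) (n : nat).

(** In a domain the lowest terms of the factors multiply to a nonzero term, and so do the highest.
    Both products sit in degree [N], so order and degree agree for each factor. *)
Lemma monomial_factor (D : idomainType) (p q : {poly D}) N :
  p != 0 -> q != 0 -> (forall i, (p * q)`_i != 0 -> i = N) ->
  forall i, p`_i != 0 -> i = (size p).-1.
Proof.
move=> p0 q0 pqN.
have ord (r : {poly D}) : r != 0 ->
    exists o, [/\ r`_o != 0, forall j, (j < o)%N -> r`_j = 0 & (o <= (size r).-1)%N].
  move=> r0; have ex : exists o, r`_o != 0 by exists (size r).-1; rewrite lead_coef_eq0.
  case: (ex_minnP ex) => o ro mino; exists o; split=> // [j lt_jo|].
    by apply/eqP/negPn/negP => /mino; rewrite leqNgt lt_jo.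
  by apply: mino; rewrite lead_coef_eq0.
have [op [pop minp lep]] := ord p p0; have [oq [qoq minq leq]] := ord q q0.
have /pqN eN1 : (p * q)`_(op + oq) != 0.
  rewrite coefM (bigD1 (inord op : 'I_(op + oq).+1)) //= inordK ?ltnS ?leq_addr //.
  rewrite addKn big1 ?addr0 ?mulf_neq0 // => j ne_j.
  have [lt|le] := ltnP j op; first by rewrite minp ?mul0r.
  rewrite [q`__]minq ?mulr0 //.
  have : j != op :> nat by apply: contraNneq ne_j => e;
    apply/eqP/val_inj; rewrite /= inordK // ltnS leq_addr.
  by have := ltn_ord j; move: le; lia.
have /pqN eN2 : (p * q)`_((size p).-1 + (size q).-1) != 0.
  have := lead_coef_eq0 (p * q); rewrite mulf_eq0 (negbTE p0) (negbTE q0) /= => /negbT.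
  rewrite /lead_coef size_mul //; move: p0 q0; rewrite -!size_poly_gt0.
  by case: (size p) => // a; case: (size q) => // b; rewrite addSn addnS /=.
move=> i pi0; have : (op <= i)%N by rewrite leqNgt; apply/negP => /minp e; rewrite e eqxx in pi0.
have : (i < size p)%N by rewrite ltnNge; apply/negP => /(nth_default 0) e; rewrite e eqxx in pi0.
by move: lep leq eN1 eN2; clear; lia.
Qed.


(** The torus action of weight [w], with the outer variable as parameter: the coefficient of its
    [d]-th power is the component of weight [d]. *)
Let grade (w : 'I_n -> nat) : {mpoly K[n]} -> {poly {mpoly K[n]}} :=
  mmap (polyC \o @mpolyC n K) (fun i => ('X_i)%:P * 'X^(w i)).

Lemma coef_grade w Q d m : (grade w Q)`_d@_m = if wt w m == d then Q@_m else 0.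
Proof.
rewrite /grade /mmap coef_sum raddf_sum /=.
have termE m' : (((Q@_m')%:MP)%:P * mmap1 (fun i => ('X_i)%:P * 'X^(w i)) m')`_d@_m =
   if (m' == m) && (wt w m == d) then Q@_m else 0.
  have -> : mmap1 (fun i => ('X_i : {mpoly K[n]})%:P * 'X^(w i)) m' = ('X_[m'])%:P * 'X^(wt w m').
    rewrite /mmap1 mpolyXE_id rmorph_prod /wt -prodrXr -big_split /=.
    by apply: eq_bigr => i _; rewrite exprMn rmorphXn /= exprM.
  rewrite mulrA -polyCM coefCM coefXn [_ * 'X_[m']]mulrC; case: eqVneq => [->|ne].
    rewrite mulr1 mulrC mcoeffCM mcoeffX; case: eqVneq => [->|ne']; last by rewrite mulr0.
    by rewrite mulr1 eqxx.
  rewrite mulr0 mcoeff0; case: eqVneq => //= <-; case: eqVneq => // e.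
  by rewrite e eqxx in ne.
under eq_bigr do rewrite termE.
have [mQ|mQ] := boolP (m \in msupp Q).
  rewrite (bigD1_seq m) ?msupp_uniq //= eqxx big1 ?addr0 // => m' /negbTE ->.
  by [].
rewrite big1_seq ?(memN_msupp_eq0 mQ) ?if_same // => m' /=.
by case: eqVneq => // ->; rewrite (negbTE mQ).
Qed.

(* Grading the variables turns homogeneous elements into monomials in one
   variable, and factors of monomials are monomials. *)
Lemma homogeneous_factor w (G H : {mpoly K[n]}) N : G != 0 -> H != 0 ->
  (forall m, (G * H)@_m != 0 -> wt w m = N) ->
  exists N1, forall m, G@_m != 0 -> wt w m = N1.
Proof.
move=> G0 H0 GHN.
have grade0 Q : Q != 0 -> grade w Q != 0.
  apply: contraNneq => e; apply/eqP/mpolyP => m.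
  by have := coef_grade w Q (wt w m) m; rewrite e coef0 !mcoeff0 eqxx => /esym.
exists (size (grade w G)).-1 => m Gm.
apply: (@monomial_factor _ _ (grade w H) N); rewrite ?grade0 //.
  move=> i; rewrite -rmorphM /= => nz.
  have [m' nzm'] : exists m', (grade w (G * H))`_i@_m' != 0.
    apply: contrapT => no; case/eqP: nz; apply/mpolyP => m'.
    by rewrite mcoeff0; apply/eqP/negPn/negP => ?; apply: no; exists m'.
  move: nzm'; rewrite coef_grade; case: (eqVneq (wt w m') i) => [<-|]; last by rewrite eqxx.
  exact: GHN.
apply: contraNneq Gm => e; have := coef_grade w G (wt w m) m.
by rewrite e mcoeff0 eqxx => /esym ->.
Qed.

End HomogeneousFactor.

(** Reducing the multiplier of [h] modulo [g] bounds [B]; comparing degrees in [A * g = D - B * h]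
    then bounds [A]. This is the surjectivity of the Sylvester map. *)
Lemma bezout_size (K : fieldType) (g h D : {poly K}) k1 k2 :
  coprimep g h -> size g = k1.+1 -> size h = k2.+1 -> (size D <= k1 + k2)%N ->
  exists A B, [/\ D = A * g + B * h, (size A <= k2)%N & (size B <= k1)%N].
Proof.
move=> /Bezout_eq1_coprimepP[[u v] /= uv1] sg sh sD.
have g0 : g != 0 by rewrite -size_poly_gt0 sg.
pose B := (D * v) %% g; pose A := D * u + (D * v) %/ g * h.
have DE : D = A * g + B * h.
  have e := divp_eq (D * v) g.
  have -> : B = D * v - (D * v) %/ g * g by apply/eqP; rewrite eq_sym subr_eq addrC -e.
  rewrite /A -[LHS]mulr1 -uv1.
  by ring.
have sB : (size B <= k1)%N by rewrite -ltnS -sg ltn_modp.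
exists A, B; split=> //.
have [->|A0] := eqVneq A 0; first by rewrite size_poly0.
have : (size (A * g)%R <= k1 + k2)%N.
  have -> : A * g = D - B * h by rewrite DE addrK.
  apply: leq_trans (size_polyD _ _) _; rewrite size_polyN geq_max sD /=.
  apply: leq_trans (size_polyMleq _ _) _; rewrite sh addnS /=.
  by rewrite leq_add2r.
by rewrite size_mul // sg addnS /= addnC leq_add2l.
Qed.

(** * Balanced weights and binary forms *)

Section SupportIn.
Variables (R : comRingType) (n : nat).
Implicit Types (T : 'X_{1..n} -> Prop) (P Q : {mpoly R[n]}).

Definition supp_in T Q := forall m, Q@_m != 0 -> T m.

Lemma supp_in0 T : supp_in T 0.
Proof. by move=> m; rewrite mcoeff0 eqxx. Qed.

Lemma supp_inW T T' Q : (forall m, T m -> T' m) -> supp_in T Q -> supp_in T' Q.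
Proof. by move=> TT' TQ m /TQ /TT'. Qed.

Lemma supp_inD T P Q : supp_in T P -> supp_in T Q -> supp_in T (P + Q).
Proof.
move=> TP TQ m; rewrite mcoeffD; have [->|/TP //] := eqVneq P@_m 0.
by rewrite add0r => /TQ.
Qed.

Lemma supp_inN T P : supp_in T P -> supp_in T (- P).
Proof. by move=> TP m; rewrite mcoeffN oppr_eq0 => /TP. Qed.

Lemma supp_inB T P Q : supp_in T P -> supp_in T Q -> supp_in T (P - Q).
Proof. by move=> TP /supp_inN; apply: supp_inD. Qed.

Lemma supp_inZ T c P : supp_in T P -> supp_in T (c *: P).
Proof.
move=> TP m; rewrite mcoeffZ => cP; apply: TP.
by apply: contraNneq cP => ->; rewrite mulr0.
Qed.

Lemma supp_inX T m : T m -> supp_in T 'X_[m].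
Proof. by move=> Tm m'; rewrite mcoeffX; case: (eqVneq m m') => [<-|]; rewrite ?eqxx. Qed.

Lemma supp_in_sum T (I : Type) (r : seq I) (S : pred I) (F : I -> {mpoly R[n]}) :
  (forall i, S i -> supp_in T (F i)) -> supp_in T (\sum_(i <- r | S i) F i).
Proof. by move=> TF; apply: big_ind => //; [exact: supp_in0 | exact: supp_inD]. Qed.

Lemma supp_inM T1 T2 T P Q : (forall m1 m2, T1 m1 -> T2 m2 -> T (m1 + m2)%MM) ->
  supp_in T1 P -> supp_in T2 Q -> supp_in T (P * Q).
Proof.
move=> TT TP TQ; rewrite mpolyME big_seq; apply: supp_in_sum => -[m1 m2] /=.
case/allpairsP=> -[p1 p2] /= [P1 Q2 [-> ->]].
apply: supp_inZ; apply: supp_inX; apply: TT; first by apply: TP; rewrite -mcoeff_msupp.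
by apply: TQ; rewrite -mcoeff_msupp.
Qed.

Lemma mcoeffXM m Q k : ('X_[m] * Q)@_(m + k) = Q@_k.
Proof. by rewrite mulrC mcoeffMX. Qed.

End SupportIn.

(* The weights [w] with [wt w cp = wt w cm] are those orthogonal to [cp - cm]. *)
Definition bal_eq n (cp cm m m' : 'X_{1..n}) :=
  forall w, wt w cp = wt w cm -> wt w m = wt w m'.
(** The difference [m' - m] lies in the cone dual to the balanced weights, that is, in the
    nonnegative orthant plus the line spanned by [cp - cm]. Natural weights suffice because the cone
    of balanced weights is rational. *)
Definition bal_le n (cp cm m m' : 'X_{1..n}) :=
  forall w, wt w cp = wt w cm -> (wt w m <= wt w m')%N.

Section Balanced.
Variables (n : nat) (cp cm : 'X_{1..n}).
Hypothesis disj : forall i, cp i = 0%N \/ cm i = 0%N.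

Lemma bal_le_zero m m' i : bal_le cp cm m m' -> cp i = 0%N -> cm i = 0%N ->
  (m i <= m' i)%N.
Proof.
move=> /(_ (fun l => l == i)) le cpi cmi.
have wtE q : wt (fun l : 'I_n => l == i) q = q i.
  rewrite /wt (bigD1 i) //= eqxx mul1n big1 ?addn0 // => j /negbTE->.
  by rewrite mul0n.
by move: le; rewrite !wtE cpi cmi; apply.
Qed.

(* the extreme rays of the cone of balanced weights *)
Lemma bal_le_ray m m' i j : bal_le cp cm m m' -> (0 < cp i)%N -> (0 < cm j)%N ->
  (cm j * m i + cp i * m j <= cm j * m' i + cp i * m' j)%N.
Proof.
move=> /(_ (fun l => (l == i) * cm j + (l == j) * cp i)%N) le cpi cmj.
have wtE q : wt (fun l => (l == i) * cm j + (l == j) * cp i)%N q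
    = (cm j * q i + cp i * q j)%N.
  rewrite /wt; under eq_bigr do rewrite mulnDl -!mulnA.
  rewrite big_split /=; congr addn.
    by rewrite (bigD1 i) //= eqxx mul1n big1 ?addn0 // => l /negbTE->.
  by rewrite (bigD1 j) //= eqxx mul1n big1 ?addn0 // => l /negbTE->.
have cpj : cp j = 0%N by case: (disj j) cmj => // ->.
have cmi : cm i = 0%N by case: (disj i) cpi => // ->.
by move: le; rewrite !wtE cpj cmi !muln0 addn0 add0n mulnC; apply.
Qed.

End Balanced.

Lemma poly_sum_widen (R : ringType) (p : {poly R}) k : (size p <= k)%N ->
  p = \sum_(i < k) p`_i *: 'X^i.
Proof.
move=> sp; rewrite -poly_def; apply/polyP => i; rewrite coef_poly.
by case: ltnP => // ki; rewrite nth_default //; apply: leq_trans ki.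
Qed.

Section Homogenization.
Variables (K : fieldType) (n : nat) (cp cm : 'X_{1..n}).
Hypothesis disj : forall i, cp i = 0%N \/ cm i = 0%N.
Hypothesis cp_neq0 : exists i, (0 < cp i)%N.

(* locked, lest [wtD] rewrite inside *)
Definition hmono k j : 'X_{1..n} := locked (cp *+ j + cm *+ (k - j))%MM.

Lemma hmonoE k j i : hmono k j i = (cp i * j + cm i * (k - j))%N.
Proof. by rewrite /hmono -lock mnmDE !mulmnE. Qed.

Lemma hmono0 k : hmono k 0 = (cm *+ k)%MM.
Proof. by rewrite /hmono -lock mulm0n add0m subn0. Qed.

Lemma hmono_inj k j j' : hmono k j = hmono k j' -> j = j'.
Proof.
move=> e; have [i cpi] := cp_neq0.
have cmi : cm i = 0%N by case: (disj i) cpi => // ->.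
have := congr1 (fun m : 'X_{1..n} => m i) e.
by rewrite /= !hmonoE cmi !mul0n !addn0 => /eqP; rewrite eqn_pmul2l // => /eqP.
Qed.

Lemma hmonoD k l i j : (i <= k)%N -> (j <= l)%N ->
  (hmono k i + hmono l j)%MM = hmono (k + l) (i + j).
Proof. by move=> ik jl; apply/mnmP => t; rewrite mnmDE !hmonoE; nia. Qed.

Lemma wt_hmono w k j : wt w cp = wt w cm -> (j <= k)%N ->
  wt w (hmono k j) = (wt w cm * k)%N.
Proof. by move=> e jk; rewrite /hmono -lock wtD !wtMn e -mulnDr subnKC. Qed.

(** The homogenization of [p] in degree [k], evaluated at [X^cp] and [X^cm]. Terms of [p] beyond
    degree [k] are dropped, whence the size bounds in the product formula. *)
Definition hform k (p : {poly K}) : {mpoly K[n]} := \sum_(j < k.+1) p`_j *: 'X_[hmono k j].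

Lemma hform_sum k (I : Type) (r : seq I) (F : I -> {poly K}) :
  hform k (\sum_(i <- r) F i) = \sum_(i <- r) hform k (F i).
Proof.
rewrite /hform exchange_big; apply: eq_bigr => j _.
by rewrite coef_sum scaler_suml.
Qed.

Lemma hformD k p q : hform k (p + q) = hform k p + hform k q.
Proof. by rewrite /hform -big_split; apply: eq_bigr => j _; rewrite coefD scalerDl. Qed.

Lemma hformZXn k c i : (i <= k)%N -> hform k (c *: 'X^i) = c *: 'X_[hmono k i].
Proof.
move=> ik; have ik' : (i < k.+1)%N by [].
rewrite /hform (bigD1 (Ordinal ik')) //= coefZ coefXn eqxx mulr1 big1 ?addr0 // => j ne.
rewrite coefZ coefXn (_ : (j == i :> nat) = false) ?mulr0 ?scale0r //.
by apply: contraNF ne => /eqP e; apply/eqP/val_inj.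
Qed.

Lemma hformM k l (p q : {poly K}) : (size p <= k.+1)%N -> (size q <= l.+1)%N ->
  hform (k + l) (p * q) = hform k p * hform l q.
Proof.
move=> sp sq.
have pE : p = \sum_(i < k.+1) p`_i *: 'X^i by exact: poly_sum_widen.
have qE : q = \sum_(i < l.+1) q`_i *: 'X^i by exact: poly_sum_widen.
rewrite {1}pE {1}qE mulr_suml hform_sum [in RHS]/hform mulr_suml; apply: eq_bigr => i _.
rewrite mulr_sumr hform_sum mulr_sumr; apply: eq_bigr => j _.
have ik : (i <= k)%N by rewrite -ltnS. have jl : (j <= l)%N by rewrite -ltnS.
rewrite -scalerAl -scalerAr scalerA -exprD hformZXn; last exact: leq_add.
by rewrite -scalerAl -scalerAr scalerA -hmonoD // mpolyXD.
Qed.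

Lemma coef_hform k (p : {poly K}) j : (j <= k)%N -> (hform k p)@_(hmono k j) = p`_j.
Proof.
move=> jk; have jk' : (j < k.+1)%N by [].
rewrite /hform raddf_sum (bigD1 (Ordinal jk')) //= mcoeffZ mcoeffX eqxx mulr1.
rewrite big1 ?addr0 // => i ne; rewrite mcoeffZ mcoeffX.
rewrite (_ : (_ == _) = false) ?mulr0 //; apply: contraNF ne => /eqP /hmono_inj e.
exact/eqP/val_inj.
Qed.

Lemma supp_hform k (p : {poly K}) :
  supp_in (fun m => exists j, [/\ (j <= k)%N, m = hmono k j & p`_j != 0]) (hform k p).
Proof.
apply: supp_in_sum => j _; have [->|nz] := eqVneq p`_j 0.
  by rewrite scale0r; apply: supp_in0.
by apply: supp_inZ; apply: supp_inX; exists j; rewrite -ltnS.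
Qed.

End Homogenization.

(** * Decomposition of monomials along [G] and [H] *)

Section Decomposition.
Variables (K : fieldType) (n : nat).
Implicit Types (cp cm m a e : 'X_{1..n}) (G H D : {mpoly K[n]}).

(** Here [a1] and [a2] stand for exponents of [G] and [H]: the support conditions make [A * G] and
    [B * H] homogeneous of the degree of [m] for every balanced weight. Degrees are compared after
    adding, as exponents cannot be subtracted. *)
Definition dec cp cm G H a1 a2 m D := exists A B,
  [/\ D = A * G + B * H,
      supp_in (fun m' => bal_eq cp cm (m' + a1)%MM m) A &
      supp_in (fun m' => bal_eq cp cm (m' + a2)%MM m) B].

Lemma decZD cp cm G H a1 a2 m c D D' : dec cp cm G H a1 a2 m D ->
  dec cp cm G H a1 a2 m D' -> dec cp cm G H a1 a2 m (c *: D + D').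
Proof.
move=> [A [B [-> sA sB]]] [A' [B' [-> sA' sB']]].
exists (c *: A + A'), (c *: B + B').
split; [by rewrite -!mul_mpolyC; ring | |]; by apply: supp_inD => //; apply: supp_inZ.
Qed.

Lemma dec0 cp cm G H a1 a2 m : dec cp cm G H a1 a2 m 0.
Proof. by exists 0, 0; rewrite !mul0r addr0; split=> //; apply: supp_in0. Qed.

Lemma dec_bal cp cm G H a1 a2 b1 b2 m m' D :
  bal_eq cp cm a1 b1 -> bal_eq cp cm a2 b2 -> bal_eq cp cm m m' ->
  dec cp cm G H a1 a2 m D -> dec cp cm G H b1 b2 m' D.
Proof.
move=> ab1 ab2 mm' [A [B [DE sA sB]]]; exists A, B; split=> // q nz w bal.
  by rewrite -mm' // -(sA q nz) // !wtD ab1.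
by rewrite -mm' // -(sB q nz) // !wtD ab2.
Qed.

(** Exchanging [cp] and [cm] does not change the balanced weights, so one reduction argument serves
    both end monomials of [G]. *)
Lemma dec_sym cp cm G H a1 a2 m D :
  dec cp cm G H a1 a2 m D -> dec cm cp G H a1 a2 m D.
Proof.
by move=> [A [B [DE sA sB]]]; exists A, B; split=> // q nz w bal; [apply: sA | apply: sB].
Qed.

(* Division by the monomial of [G] that is pure in [cm]: it moves an exponent
   lying below [e] in the directions of [cp] back above [e]. *)
Lemma dec_reduce cp cm G H e k1 k2 (g : nat -> K) :
  (forall i, cp i = 0%N \/ cm i = 0%N) ->
  g 0%N != 0 -> G = \sum_(j < k1.+1) g j *: 'X_[hmono cp cm k1 j] ->
  let a := (e + cm *+ (k1 + k2))%MM in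
  let decX m := dec cp cm G H (cm *+ k1) (e + cm *+ k2) m 'X_[m] in
  (forall m, bal_le cp cm a m -> (e <= m)%MM -> decX m) ->
  forall m, bal_le cp cm a m -> (forall j, (0 < cm j)%N -> (e j <= m j)%N) -> decX m.
Proof.
move=> disj g0 GE a decX base m.
have [d] := ubnP (\sum_i (e i - m i))%N; elim: d m => // d IHd m lt_d aS negS.
have [le_em|nle_em] := boolP (e <= m)%MM; first exact: base.
have [i lt_i] : exists i, (m i < e i)%N.
  apply: contrapT => no; case/negP: nle_em; apply/mnm_lepP => i.
  by rewrite leqNgt; apply/negP => lt; apply: no; exists i.
have cmi : cm i = 0%N.
  by apply/eqP; rewrite -leqn0 leqNgt; apply/negP => /negS; rewrite leqNgt lt_i.
have aE j : a j = (e j + cm j * (k1 + k2))%N by rewrite mnmDE mulmnE.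
have cpi : (0 < cp i)%N.
  rewrite lt0n; apply/eqP => cpi; have := bal_le_zero aS cpi cmi.
  by rewrite aE cmi mul0n addn0 leqNgt lt_i.
(* The deficit of [m] at [i] must be made up at every [j] where [cm] is positive: the ray of [i] and
   [j] leaves room there for all of [cm *+ (k1 + k2)] above [e]. *)
have cm_le j : (cm j * (k1 + k2) + e j <= m j)%N \/ cm j = 0%N.
  have [->|] := eqVneq (cm j) 0%N; [by right | rewrite -lt0n => cmj; left].
  have cpj : cp j = 0%N by case: (disj j) cmj => // ->.
  have := bal_le_ray disj aS cpi cmj; rewrite !aE cmi => ray.
  have {}ray : (cp i * (e j + cm j * (k1 + k2)) < cp i * m j)%N by nia.
  by rewrite ltn_pmul2l // in ray; rewrite addnC ltnW.
have le_m : (cm *+ k1 <= m)%MM.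
  apply/mnm_lepP => j; rewrite mulmnE; case: (cm_le j) => [|->]; last by rewrite mul0n.
  by nia.
pose r := (m - cm *+ k1)%MM.
have rE : (r + cm *+ k1)%MM = m by rewrite submK.
pose q j := (r + hmono cp cm k1 j)%MM.
have q0 : q 0%N = m by rewrite /q hmono0.
have rG : 'X_[r] * G = \sum_(j < k1.+1) g j *: 'X_[q j].
  by rewrite GE mulr_sumr; apply: eq_bigr => j _; rewrite -scalerAr -mpolyXD.
(* Solving ['X_[r] * G] for its pure [cm] term replaces [m] by its translates by positive multiples
   of [cp - cm]. These fill the deficit at [i], and the room found above keeps the [cm] coordinates
   at least [e]. *)
have XE : 'X_[m] = (g 0%N)^-1 *: ('X_[r] * G) +
    \sum_(j < k1) (- (g 0%N)^-1 * g j.+1) *: 'X_[q j.+1].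
  rewrite rG big_ord_recl /= q0 scalerDr scalerA mulVf // scale1r -addrA scaler_sumr.
  rewrite -big_split big1 ?addr0 //= => j _.
  by rewrite scalerA mulNr scaleNr subrr.
have qm j : (j <= k1)%N -> bal_eq cp cm (q j) m.
  by move=> jk w bal; rewrite -[in RHS]rE /q (wtD w r) wt_hmono // wtD wtMn.
rewrite /decX XE; apply: decZD.
  exists 'X_[r], 0; rewrite mul0r addr0; split=> //; last exact: supp_in0.
  by apply: supp_inX => w _; rewrite rE.
elim/big_rec: _ => [|j D _ decD]; first exact: dec0.
apply: decZD decD; have jk : (j.+1 <= k1)%N by [].
apply: dec_bal (qm _ jk) _ => //.
have qE l : q j.+1 l = (m l - cm l * k1 + (cp l * j.+1 + cm l * (k1 - j.+1)))%N.
  by rewrite mnmDE hmonoE mnmBE mulmnE.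
apply: IHd => [||l cml].
- apply: leq_trans (_ : \sum_i (e i - m i) <= d)%N; last by rewrite -ltnS.
  rewrite (bigD1 i) //= [X in (_ < X)%N](bigD1 i) //= -addSn leq_add //.
    by rewrite qE cmi; nia.
  apply: leq_sum => l _; rewrite qE; case: (cm_le l) => [|->].
    by case: (disj l) => ->; nia.
  by nia.
- by move=> w bal; rewrite qm //; apply: aS.
- rewrite qE; case: (cm_le l) => [|e0]; last by rewrite e0 in cml.
  by nia.
Qed.

End Decomposition.

Lemma seq_argmin d (T : orderType d) (I : eqType) (f : I -> T) (s : seq I) i0 :
  i0 \in s -> exists2 i, i \in s & forall j, j \in s -> (f i <= f j)%O.
Proof.
elim: s i0 => // i1 s IHs i0 _; case: s IHs => [_|i2 s IHs].
  by exists i1; rewrite ?inE // => j; rewrite inE => /eqP->.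
have [|i si mini] := IHs i2; first by rewrite inE eqxx.
have [le|lt] := Order.TotalTheory.leP (f i1) (f i).
  exists i1; rewrite ?inE ?eqxx // => j; rewrite inE => /orP[/eqP->//|/mini].
  exact: Order.POrderTheory.le_trans.
exists i; first by rewrite inE si orbT.
move=> j; rewrite inE => /orP[/eqP->|/mini//].
exact: Order.POrderTheory.ltW.
Qed.

Section MonomialDecomposition.
Variables (K : fieldType) (n : nat) (cp cm e : 'X_{1..n}) (k1 k2 : nat).
Variables (g h : {poly K}).
Hypothesis disj : forall i, cp i = 0%N \/ cm i = 0%N.
Hypotheses (sg : size g = k1.+1) (sh : size h = k2.+1).
Hypotheses (g0 : g`_0 != 0) (gh : coprimep g h).
Let a := (e + cm *+ (k1 + k2))%MM.
Let G := hform cp cm k1 g.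
Let H := 'X_[e] * hform cp cm k2 h.
Let decX m := dec cp cm G H (cm *+ k1) (e + cm *+ k2) m 'X_[m].

(** Take the largest [T < k1 + k2] for which [e + cp *+ T] fits under [m] in all coordinates. If [T]
    is not the last value, the next one fails at some [i'], and the rays through [i'] turn this
    failure into the room needed at the [cm] coordinates. *)
Lemma below_monomial m : (0 < k1)%N -> bal_le cp cm a m -> (e <= m)%MM ->
  exists2 j, (j < k1 + k2)%N & (e + hmono cp cm (k1 + k2).-1 j <= m)%MM.
Proof.
move=> k1_gt0 aS /mnm_lepP le_em.
pose Pj j := (j < k1 + k2)%N && [forall i, (e i + cp i * j <= m i)%N].
have exP : exists j, Pj j.
  exists 0%N; rewrite /Pj addn_gt0 k1_gt0; apply/forallP => i.
  by rewrite muln0 addn0.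
have ubP j : Pj j -> (j <= k1 + k2)%N by case/andP=> /ltnW.
case: (ex_maxnP exP ubP) => T /andP[Tk /forallP le_T maxT]; exists T => //.
apply/mnm_lepP => i; rewrite mnmDE hmonoE.
case: (posnP (cm i)) => [->|cmi]; first by have := le_T i; lia.
have cpi : cp i = 0%N by case: (disj i) cmi => // ->.
have [eT|neT] := eqVneq T (k1 + k2).-1.
  by have := le_em i; rewrite cpi eT subnn; lia.
have /negP : ~ Pj T.+1 by move=> /maxT; rewrite ltnn.
have T1 : (T.+1 < k1 + k2)%N by move: Tk neT; lia.
rewrite /Pj T1 negb_forall => /existsP[i' ].
rewrite -ltnNge => lt_i'.
have cpi' : (0 < cp i')%N.
  by rewrite lt0n; apply: contraTneq lt_i' => ->; rewrite mul0n addn0 -leqNgt.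
have := bal_le_ray disj aS cpi' cmi; rewrite /a !mnmDE !mulmnE.
have -> : cm i' = 0%N by case: (disj i') cpi' => // ->.
rewrite cpi mul0n !addn0 add0n => ray.
have lt : (cp i' * (e i + cm i * (k1 + k2)) < cp i' * (cm i * T.+1 + m i))%N.
  have : (cm i * m i' < cm i * (e i' + cp i' * T.+1))%N by rewrite ltn_pmul2l.
  by move: ray; rewrite !mulnDr; nia.
rewrite ltn_pmul2l // in lt.
have -> : ((k1 + k2).-1 - T = k1 + k2 - T.+1)%N by lia.
by rewrite mulnBr; nia.
Qed.

(** Every binary form of degree [k1 + k2 - 1] is a combination of the homogenizations of [g] and
    [h], with multipliers of degrees [k2 - 1] and [k1 - 1]; [m] is divisible by ['X_[e]] times a
    monomial of that degree. *)
Lemma dec_above m : (0 < k1)%N -> bal_le cp cm a m -> (e <= m)%MM -> decX m.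
Proof.
move=> k1_gt0 aS le_em; have [j jk le_jm] := below_monomial k1_gt0 aS le_em.
have [|A [B [XE sA sB]]] := bezout_size (D := 'X^j) gh sg sh.
  by rewrite size_polyXn.
(* For [k2 = 0] the size bound forces [A = 0], and there is no degree [k2 - 1] in which to
   homogenize. *)
pose hA := if k2 is k2'.+1 then hform cp cm k2' A else 0.
pose hB := hform cp cm k1.-1 B.
pose r := (m - (e + hmono cp cm (k1 + k2).-1 j))%MM.
have rE : (r + (e + hmono cp cm (k1 + k2).-1 j))%MM = m by rewrite submK.
have hmE : 'X_[hmono cp cm (k1 + k2).-1 j] = hA * G + hB * hform cp cm k2 h.
  rewrite -[LHS]scale1r -hformZXn; last by move: jk; lia.
  rewrite scale1r XE hformD; congr (_ + _).
    rewrite /hA /G; case: (k2) sA => [|k2'] sA.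
      move: sA; rewrite leqn0 size_poly_eq0 => /eqP->.
      by rewrite !mul0r /hform big1 // => i _; rewrite coef0 scale0r.
    by rewrite -hformM ?sg //; congr hform; lia.
  by rewrite /hB -hformM ?sh ?prednK //; congr hform; move: k1_gt0; lia.
exists ('X_[r + e] * hA), ('X_[r] * hB); split.
- rewrite -{1}rE mpolyXD [in X in _ * X = _]mpolyXD hmE mpolyXD /H; ring.
- rewrite /hA; case k2E: (k2) => [|k2']; first by rewrite mulr0; exact: supp_in0.
  apply: (supp_inM (T1 := eq (r + e)%MM)
    (T2 := fun m' => exists j, [/\ (j <= k2')%N, m' = hmono cp cm k2' j & A`_j != 0]));
    first 1 last.
  + exact: supp_inX.
  + exact: supp_hform.
  move=> _ _ <- [j' [j'k -> _]] w bal; rewrite -rE.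
  by rewrite !wtD !wtMn !wt_hmono //; [rewrite k2E; lia | move: jk; lia].
- apply: (supp_inM (T1 := eq r)
    (T2 := fun m' => exists j, [/\ (j <= k1.-1)%N, m' = hmono cp cm k1.-1 j & B`_j != 0]));
    first 1 last.
  + exact: supp_inX.
  + exact: supp_hform.
  move=> _ _ <- [j' [j'k -> _]] w bal; rewrite -rE.
  by rewrite !wtD !wtMn !wt_hmono //; move: jk k1_gt0; nia.
Qed.

(** An exponent cannot fall short of [e] both at a [cp] coordinate and at a [cm] coordinate, since
    the ray joining the two would be violated. Hence one of the two end monomials of [G] is
    available for reduction. For [k1 = 0], [G] is a nonzero constant. *)
Lemma dec_monomial m : bal_le cp cm a m -> decX m.
Proof.
move=> aS; have [k1_0|k1_gt0] := posnP k1.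
  exists ((g`_0)^-1 *: 'X_[m]), 0; split; last exact: supp_in0.
    rewrite mul0r addr0 /G k1_0 /hform big_ord1 hmono0 mulm0n mpolyX0.
    by rewrite -scalerAl -scalerAr mulr1 scalerA mulVf ?scale1r.
  by apply: supp_inZ; apply: supp_inX => w _; rewrite k1_0 mulm0n addm0.
have base m' : bal_le cp cm a m' -> (e <= m')%MM -> decX m' by exact: dec_above.
have [le_neg|] := pselect (forall j, (0 < cm j)%N -> (e j <= m j)%N).
  by apply: (dec_reduce disj g0 (erefl _) base).
move=> /existsNP[j /not_implyP[cmj /negP]]; rewrite -ltnNge => lt_j.
have disj' i : cm i = 0%N \/ cp i = 0%N by case: (disj i); [right | left].
have bal_cpm b k : bal_eq cm cp (b + cp *+ k)%MM (b + cm *+ k)%MM.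
  by move=> w bal; rewrite !wtD !wtMn bal.
have lift_dec q : dec cm cp G H (cp *+ k1) (e + cp *+ k2) q 'X_[q] -> decX q.
  move=> /dec_sym; apply: dec_bal => // w bal; last by rewrite !wtD !wtMn bal.
  by rewrite !wtMn bal.
have drop_dec q : decX q -> dec cm cp G H (cp *+ k1) (e + cp *+ k2) q 'X_[q].
  move=> /dec_sym; apply: dec_bal => // w bal; last by rewrite !wtD !wtMn bal.
  by rewrite !wtMn bal.
(* Reading [g] backwards exchanges the two directions; its leading coefficient takes the place of
   the constant term. *)
have GE : G = \sum_(i < k1.+1) g`_(k1 - i) *: 'X_[hmono cm cp k1 i].
  rewrite /G /hform (reindex_inj rev_ord_inj) /=; apply: eq_bigr => i _.
  rewrite subSS; congr (_ *: 'X_[_]); apply/mnmP => l; rewrite !hmonoE.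
  by rewrite subKn 1?addnC // -ltnS.
apply: lift_dec; apply: (dec_reduce (k2 := k2) disj' (g := fun i => g`_(k1 - i)) _ GE).
- by rewrite subn0 -[k1]/(k1.+1.-1) -sg -/(lead_coef g) lead_coef_eq0 -size_poly_gt0 sg.
- move=> q aq le_eq; apply: drop_dec; apply: base => // w bal.
  by have := aq w (esym bal); rewrite !wtD !wtMn bal.
- by move=> w bal; have := aS w (esym bal); rewrite !wtD !wtMn bal.
move=> i cpi; rewrite leqNgt; apply/negP => lt_i.
have := bal_le_ray disj aS cpi cmj; rewrite /a !mnmDE !mulmnE.
have -> : cm i = 0%N by case: (disj i) cpi => // ->.
by nia.
Qed.

Lemma dec_poly D : supp_in (bal_le cp cm a) D -> exists A B, [/\ D = A * G + B * H,
  supp_in (fun m' => exists2 m, D@_m != 0 & bal_eq cp cm (m' + cm *+ k1)%MM m) A &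
  supp_in (fun m' => exists2 m, D@_m != 0 & bal_eq cp cm (m' + (e + cm *+ k2))%MM m) B].
Proof.
move=> aD.
suff: exists A B, [/\ \sum_(m <- msupp D) D@_m *: 'X_[m] = A * G + B * H,
  supp_in (fun m' => exists2 m, D@_m != 0 & bal_eq cp cm (m' + cm *+ k1)%MM m) A &
  supp_in (fun m' => exists2 m, D@_m != 0 & bal_eq cp cm (m' + (e + cm *+ k2))%MM m) B].
  by move=> [A [B]]; rewrite -mpolyE => ?; exists A, B.
rewrite big_seq; elim/big_rec: _ => [|m D' mD [A [B [-> sA sB]]]].
  by exists 0, 0; rewrite !mul0r addr0; split=> //; apply: supp_in0.
rewrite mcoeff_msupp in mD; have [A' [B' [XE sA' sB']]] := dec_monomial (aD _ mD).
exists (D@_m *: A' + A), (D@_m *: B' + B); split.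
- by rewrite {1}XE -!mul_mpolyC; ring.
- by apply: supp_inD => //; apply: supp_inZ => m' /sA' ?; exists m.
- by apply: supp_inD => //; apply: supp_inZ => m' /sB' ?; exists m.
Qed.

End MonomialDecomposition.

(** * Polynomials supported on a lattice line *)

Section LineSupport.
Variables (K : fieldType) (n : nat) (cp cm : 'X_{1..n}).
Hypothesis disj : forall i, cp i = 0%N \/ cm i = 0%N.
Hypothesis cp_neq0 : exists i, (0 < cp i)%N.

(** The relation [m' = m + j (cp - cm)], rearranged to stay among exponents. *)
Definition lattice_line (m m' : 'X_{1..n}) j := (m' + cm *+ j)%MM = (m + cp *+ j)%MM.

Hypothesis primitive : forall m m', bal_eq cp cm m m' ->
  exists j, lattice_line m m' j \/ lattice_line m' m j.

(** A coordinate where [cp] is positive orders the support along the line. If [a] and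
    [b = a + k (cp - cm)] are its extreme exponents, nonnegativity of [b] gives [cm *+ k <= a], and
    the difference is [e]. The coefficients at [a] and [b] are the end coefficients of [p]. *)
Lemma line_polynomial (Q : {mpoly K[n]}) : Q != 0 ->
  (forall m m', Q@_m != 0 -> Q@_m' != 0 -> bal_eq cp cm m m') ->
  exists e k (p : {poly K}),
    [/\ size p = k.+1, p`_0 != 0 & Q = 'X_[e] * hform cp cm k p].
Proof.
move=> Q0 homQ; have [i0 cpi] := cp_neq0.
have cmi : cm i0 = 0%N by case: (disj i0) cpi => // ->.
have lineE m m' j i : lattice_line m m' j -> (m' i + cm i * j = m i + cp i * j)%N.
  by move=> /(congr1 (fun q : 'X_{1..n} => q i)); rewrite !mnmDE !mulmnE.
have lead := mlead_supp Q0.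
have [a aQ mina] := seq_argmin (fun m : 'X_{1..n} => m i0) lead.
have [b bQ maxb] := seq_argmin (fun m : 'X_{1..n} => (- (m i0)%:Z)%R) lead.
have {}maxb m : Q@_m != 0 -> (m i0 <= b i0)%N.
  by rewrite -mcoeff_msupp => /maxb; rewrite lerN2 lez_nat.
have {}mina m : Q@_m != 0 -> (a i0 <= m i0)%N by rewrite -mcoeff_msupp => /mina.
rewrite !mcoeff_msupp in aQ bQ.
have line m : Q@_m != 0 -> exists j, lattice_line a m j.
  move=> Qm; have [j [Lj|Lj]] := primitive (homQ _ _ aQ Qm); first by exists j.
  have := mina m Qm; have := lineE _ _ _ i0 Lj; rewrite cmi mul0n addn0 => -> le.
  have j0 : j = 0%N by nia.
  by exists 0%N; move: Lj; rewrite /lattice_line j0 !mulm0n !addm0.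
have [k Lk] := line b bQ.
have le_a : (cm *+ k <= a)%MM.
  apply/mnm_lepP => i; rewrite mulmnE; have := lineE _ _ _ i Lk.
  by case: (disj i) => ->; lia.
pose e := (a - cm *+ k)%MM; have aE : a = (e + cm *+ k)%MM by rewrite submK.
have suppQ m : Q@_m != 0 -> exists2 j, (j <= k)%N & m = (e + hmono cp cm k j)%MM.
  move=> Qm; have [j Lj] := line m Qm; exists j.
    have := maxb m Qm; have := lineE _ _ _ i0 Lk; have := lineE _ _ _ i0 Lj.
    by rewrite cmi !mul0n !addn0 => -> ->; rewrite leq_add2l leq_pmul2l.
  have jk : (j <= k)%N.
    have := maxb m Qm; have := lineE _ _ _ i0 Lk; have := lineE _ _ _ i0 Lj.
    by rewrite cmi !mul0n !addn0 => -> ->; rewrite leq_add2l leq_pmul2l.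
  apply/mnmP => i; have := lineE _ _ _ i Lj; rewrite aE !mnmDE hmonoE mulmnE.
  by nia.
exists e, k, (\poly_(j < k.+1) Q@_(e + hmono cp cm k j)).
have bE : b = (e + hmono cp cm k k)%MM.
  apply/mnmP => i; have := lineE _ _ _ i Lk; rewrite aE !mnmDE hmonoE mulmnE.
  by lia.
split.
- by rewrite size_poly_eq // -bE.
- by rewrite coef_poly /= hmono0 -aE.
have homE j : (j <= k)%N ->
    ('X_[e] * hform cp cm k (\poly_(j < k.+1) Q@_(e + hmono cp cm k j)))
      @_(e + hmono cp cm k j) = Q@_(e + hmono cp cm k j).
  by move=> jk; rewrite mcoeffXM coef_hform // coef_poly ltnS jk.
apply/mpolyP => m.
have [[j jk ->]|no] := pselect (exists2 j, (j <= k)%N & m = (e + hmono cp cm k j)%MM).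
  by rewrite homE.
have -> : Q@_m = 0 by apply/eqP/negPn/negP => /suppQ.
apply/esym/eqP/negPn/negP => nz; apply: no; move: m nz.
apply: (supp_inM (T1 := eq e)); [|exact: supp_inX|exact: supp_hform].
by move=> _ _ <- [j [jk -> _]]; exists j.
Qed.

Lemma dvd_var (Q : {mpoly K[n]}) i : (forall m, Q@_m != 0 -> (0 < m i)%N) -> mdvd 'X_i Q.
Proof.
move=> Qi; exists (\sum_(m <- msupp Q) Q@_m *: 'X_[m - U_(i)]).
rewrite mulr_sumr {1}[Q]mpolyE !big_seq; apply: eq_bigr => m.
rewrite mcoeff_msupp => /Qi mi; rewrite -scalerAr -mpolyXD addmC submK //.
by rewrite lep1mP -lt0n.
Qed.

(** The homogenized gcd divides both forms, so it is a unit and has total degree 0. But the leading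
    coefficient of the gcd sits at its degree times [cp], which is nonzero unless the gcd is
    constant. *)
Lemma hform_coprime e k1 k2 (g h : {poly K}) : size g = k1.+1 -> size h = k2.+1 ->
  rel_prime (hform cp cm k1 g) ('X_[e] * hform cp cm k2 h) -> coprimep g h.
Proof.
move=> sg sh rp; pose D := gcdp g h.
have g0 : g != 0 by rewrite -size_poly_gt0 sg.
have h0 : h != 0 by rewrite -size_poly_gt0 sh.
have D0 : D != 0 by rewrite gcdp_eq0 negb_and g0.
have dvdE (q : {poly K}) k : size q = k.+1 -> D %| q ->
    mdvd (hform cp cm (size D).-1 D) (hform cp cm k q).
  move=> sq Dq; have q0 : q != 0 by rewrite -size_poly_gt0 sq.
  have qE := divpK Dq; have d0 : q %/ D != 0.
    by apply: contraNneq q0 => e0; rewrite -qE e0 mul0r.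
  have sE : ((size D).-1 + (size (q %/ D)%R).-1)%N = k.
    have := size_mul d0 D0; rewrite qE sq; move: d0 D0; rewrite -!size_poly_gt0.
    by case: (size (q %/ D)%R) => [|u] //; case: (size D) => [|v] // _ _;
      rewrite addSn addnS /= addnC => -[->].
  exists (hform cp cm (size (q %/ D)).-1 (q %/ D)).
  by rewrite -hformM ?leqSpred // sE mulrC qE.
have /rp Du := dvdE g k1 sg (dvdp_gcdl g h).
have {Du}/Du unitD : mdvd (hform cp cm (size D).-1 D) ('X_[e] * hform cp cm k2 h).
  have [Q ->] := dvdE h k2 sh (dvdp_gcdr g h).
  by exists ('X_[e] * Q); rewrite mulrCA.
have [Q QE] : exists Q, hform cp cm (size D).-1 D * Q = 1.
  by exists (hform cp cm (size D).-1 D)^-1; rewrite divrr.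
rewrite /coprimep -/D -(prednK (_ : 0 < size D)%N) ?size_poly_gt0 // eqSS.
apply: contraT => dpos.
have hE : (hform cp cm (size D).-1 D)@_(hmono cp cm (size D).-1 (size D).-1) != 0.
  by rewrite coef_hform // -/(lead_coef D) lead_coef_eq0.
have hD0 : hform cp cm (size D).-1 D != 0.
  by apply: contraNneq hE => ->; rewrite mcoeff0.
have Q0 : Q != 0.
  by apply/eqP => e0; have := QE; rewrite e0 mulr0 => /esym/eqP; rewrite oner_eq0.
have := congr1 (fun q => msize q) QE;
rewrite msize1 msizeM // (mpolySpred _ hD0) (mpolySpred _ Q0) => sz.
have sz1 : ((msize (hform cp cm (size D).-1 D)).-1 = 0)%N by lia.
have := msize_mdeg_lt (etrans (mcoeff_msupp _ _) hE).
rewrite (mpolySpred _ hD0) sz1 ltnS leqn0 mdeg_eq0.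
have [i cpi] := cp_neq0; move=> /eqP /(congr1 (fun q : 'X_{1..n} => q i)).
by rewrite hmonoE mnm0E; move: dpos; nia.
Qed.
End LineSupport.

(** * Series and finite expansions *)

Section CoefficientSums.
Variables (R : comRingType) (n : nat).
Implicit Types (m : 'X_{1..n}) (Q : {mpoly R[n]}).

Lemma mcoeff_sumX (s : seq 'X_{1..n}) (p : pred 'X_{1..n}) (F : 'X_{1..n} -> R) m :
  uniq s -> (\sum_(i <- s | p i) F i *: 'X_[i])@_m = if (m \in s) && p m then F m else 0.
Proof.
move=> us; rewrite raddf_sum /=.
have [ms|ms] := boolP (m \in s); last first.
  rewrite big_seq_cond big1 // => i /andP[si _].
  rewrite mcoeffZ mcoeffX; case: (eqVneq i m) => [e|]; last by rewrite mulr0.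
  by rewrite -e si in ms.
rewrite big_mkcond (bigD1_seq m) //= big1 ?addr0 => [|i /negbTE ne].
  by case: (p m) => //; rewrite mcoeffZ mcoeffX eqxx mulr1.
by case: (p i) => //; rewrite mcoeffZ mcoeffX ne mulr0.
Qed.

Lemma mcoeffMX_if m Q k :
  (Q * 'X_[m])@_k = if (m <= k)%MM then Q@_(k - m) else 0.
Proof.
have [le|nle] := boolP (m <= k)%MM.
  by rewrite -{1}(submK le) addmC mcoeffMX.
apply/eqP/negPn/negP => nz; case/negP: nle; move: k nz.
apply: (supp_inM (T1 := fun _ => True) (T2 := eq m)) => //; last exact: supp_inX.
by move=> m1 _ _ <-; apply: lem_addl.
Qed.

Definition truncation (a : 'X_{1..n} -> R) k : {mpoly R[n]} :=
  \sum_(m : 'X_{1..n < k}) a m *: 'X_[m].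

Lemma mcoeff_truncation a k m :
  (truncation a k)@_m = if (mdeg m < k)%N then a m else 0.
Proof.
case: ifP => [lt|ge]; first exact: mcoeff_mpoly.
rewrite /truncation raddf_sum big1 // => i _ /=; rewrite mcoeffZ mcoeffX.
case: eqP => [e|]; last by rewrite mulr0.
by rewrite -e bmdeg in ge.
Qed.

End CoefficientSums.

Section CompleteLocal.
Variables (S : comUnitRingType) (K : fieldType) (pi : {rmorphism S -> K}).
Variables (n : nat) (x : 'I_n -> S).
Implicit Types (T : 'X_{1..n} -> Prop) (y : S) (Q : {mpoly S[n]}) (m : 'X_{1..n}).

(** The ideal generated by the monomials in [x] with exponent in [T]. *)
Definition mono_span T y := exists2 Q : {mpoly S[n]}, supp_in T Q & y = Q.@[x].

(** The [k]-th power of the ideal generated by the [x i]. *)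
Definition deg_ge k := mono_span (fun m => k <= mdeg m)%N.

Lemma mono_span_eval T Q : supp_in T Q -> mono_span T Q.@[x].
Proof. by exists Q. Qed.

Lemma mono_span0 T : mono_span T 0.
Proof. by exists 0; rewrite ?meval0 //; apply: supp_in0. Qed.

Lemma mono_spanW T T' y : (forall m, T m -> T' m) -> mono_span T y -> mono_span T' y.
Proof. by move=> TT' [Q TQ ->]; exists Q => //; apply: supp_inW TQ. Qed.

Lemma mono_spanD T y z : mono_span T y -> mono_span T z -> mono_span T (y + z).
Proof. by move=> [P TP ->] [Q TQ ->]; exists (P + Q); rewrite ?mevalD //; apply: supp_inD. Qed.

Lemma mono_spanN T y : mono_span T y -> mono_span T (- y).
Proof. by move=> [P TP ->]; exists (- P); rewrite ?mevalN //; apply: supp_inN. Qed.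

Lemma mono_spanB T y z : mono_span T y -> mono_span T z -> mono_span T (y - z).
Proof. by move=> Ty /mono_spanN; apply: mono_spanD. Qed.

Lemma mono_spanZ T c y : mono_span T y -> mono_span T (c * y).
Proof. by move=> [P TP ->]; exists (c *: P); rewrite ?mevalZ //; apply: supp_inZ. Qed.

Lemma mono_spanM T1 T2 T y z : (forall m1 m2, T1 m1 -> T2 m2 -> T (m1 + m2)%MM) ->
  mono_span T1 y -> mono_span T2 z -> mono_span T (y * z).
Proof.
move=> TT [P TP ->] [Q TQ ->]; exists (P * Q); rewrite ?mevalM //.
exact: supp_inM TT TP TQ.
Qed.

Lemma mono_span_sum T (I : Type) (r : seq I) (F : I -> S) :
  (forall i, mono_span T (F i)) -> mono_span T (\sum_(i <- r) F i).
Proof. by move=> TF; apply: big_ind => // [|? ? ? ?]; [exact: mono_span0 | exact: mono_spanD]. Qed.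

Hypothesis pi_surj : forall c, exists y, pi y = c.
Hypothesis pi_ker : forall y, pi y = 0 -> deg_ge 1 y.
Hypothesis pi_x : forall i, pi (x i) = 0.
Hypothesis pi_unit : forall y, pi y != 0 -> y \is a GRing.unit.
Hypothesis separated : forall y, (forall k, deg_ge k y) -> y = 0.
Hypothesis complete : forall u : nat -> S, (forall k, deg_ge k (u k.+1 - u k)) ->
  exists y, forall k, deg_ge k (y - u k).

Lemma pi_eval Q : pi Q.@[x] = pi Q@_0.
Proof.
rewrite {1}[Q]mpolyE (raddf_sum (meval x)) (raddf_sum pi) /=.
have termE m : pi (Q@_m *: 'X_[m]).@[x] = if m == 0%MM then pi Q@_m else 0.
  rewrite mevalZ mevalX rmorphM rmorph_prod /=.
  case: (eqVneq m 0%MM) => [->|m0].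
    by rewrite big1 ?mulr1 // => i _; rewrite mnm0E expr0 rmorph1.
  have [i mi] : exists i, m i != 0%N.
    apply: contrapT => no; case/eqP: m0; apply/mnmP => i; rewrite mnm0E.
    by apply/eqP/negPn/negP => mi; apply: no; exists i.
  by rewrite (bigD1 i) //= rmorphXn /= pi_x expr0n (negbTE mi) mul0r mulr0.
under eq_bigr do rewrite termE.
have [Q0|Q0] := boolP (0%MM \in msupp Q).
  rewrite (bigD1_seq 0%MM) ?msupp_uniq //= eqxx big1 ?addr0 // => m /negbTE ->.
  by [].
rewrite big1_seq => [|m /= mQ]; first by rewrite (memN_msupp_eq0 Q0) rmorph0.
by case: eqVneq => // m0; rewrite -m0 mQ in Q0.
Qed.

Lemma pi_deg_ge1 y : deg_ge 1 y -> pi y = 0.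
Proof.
move=> [Q sQ ->]; rewrite pi_eval; have [->|/sQ] := eqVneq Q@_0 0; first exact: rmorph0.
by rewrite mdeg0.
Qed.

(** A coefficient with zero residue lies in the ideal of the [x i], so its term moves to strictly
    larger exponents. This is what makes the errors of the lifting shrink. *)
Lemma mono_span_ker T Q : supp_in T Q -> (forall m, pi Q@_m = 0) ->
  mono_span (fun m => exists m1 m2, [/\ T m1, (0 < mdeg m2)%N & m = (m1 + m2)%MM]) Q.@[x].
Proof.
move=> TQ piQ; rewrite [Q in Q.@[x]]mpolyE (raddf_sum (meval x)) big_seq /=.
apply: big_ind => [|y z|m]; [exact: mono_span0 | exact: mono_spanD |].
rewrite mcoeff_msupp => /TQ Tm; rewrite mevalZ mulrC.
apply: (mono_spanM (T1 := eq m)) (pi_ker (piQ m)) => [_ m2 <- m2d|]; first by exists m, m2.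
by apply: mono_span_eval; apply: supp_inX.
Qed.

Definition is_sum (a : 'X_{1..n} -> S) y := forall k, deg_ge k (y - (truncation a k).@[x]).

Lemma sum_exists a : exists y, is_sum a y.
Proof.
apply: complete => k; rewrite -mevalB; apply: mono_span_eval => m.
rewrite mcoeffB !mcoeff_truncation; case: (ltnP (mdeg m) k) => // lt.
by rewrite ltnS ltnW // subrr eqxx.
Qed.

Lemma is_sum_approx a y k Q : is_sum a y ->
  (forall m, (mdeg m < k)%N -> Q@_m = a m) -> deg_ge k (y - Q.@[x]).
Proof.
move=> ay Qa; rewrite -[y](subrK (truncation a k).@[x]) -addrA.
apply: mono_spanD (ay k) _; rewrite -mevalB; apply: mono_span_eval => m.
rewrite mcoeffB mcoeff_truncation.
by case: (ltnP (mdeg m) k) => // /Qa ->; rewrite subrr eqxx.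
Qed.

Lemma pi_sum a y : is_sum a y -> pi y = pi (a 0%MM).
Proof.
move=> /(_ 1%N) /pi_deg_ge1 /eqP; rewrite rmorphB subr_eq0 => /eqP->.
by rewrite pi_eval mcoeff_truncation mdeg0.
Qed.

(* Only the minimal exponents are kept: the remaining terms of the series are
   absorbed into the coefficients of the minimal ones without changing residues. *)
Lemma finite_expansion a y : is_sum a y -> (forall m, a m != 0 -> pi (a m) != 0) ->
  exists P : {mpoly S[n]}, [/\ unit_expansion x P y, forall m, P@_m != 0 -> a m != 0 &
    forall m, a m != 0 -> (forall m', a m' != 0 -> (m' <= m)%MM -> m' = m) ->
      pi P@_m = pi (a m)].
Proof.
move=> ay unit_a.
have [B [uB memB covB]] := finitely_many_minimal (fun m => a m != 0).
have ex_beta m : exists b, a m != 0 -> b \in B /\ (b <= m)%MM.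
  have [am|am] := boolP (a m != 0); last by exists 0%MM.
  by have [b Bb le_b] := covB m am; exists b.
have [beta betaP] := choice ex_beta.
(* Each exponent of the series is charged to one minimal exponent [beta] below it, and [alpha b]
   collects those charged to [b], divided by [x^b]. A minimal [b] is charged to itself, so the sum
   of [alpha b] has the residue of [a b]. *)
pose alpha b m := if beta (m + b)%MM == b then a (m + b)%MM else 0.
have [c cP] := choice (fun b => sum_exists (alpha b)).
have pic b : b \in B -> pi (c b) = pi (a b).
  move=> Bb; have [ab minb] := (memB b).1 Bb.
  have [Bbb le] := betaP b ab.
  rewrite (pi_sum (cP b)) /alpha add0m (minb (beta b)) ?eqxx //.
  by case: ((memB (beta b)).1 Bbb).
pose P := \sum_(b <- B) c b *: 'X_[b].
have PE m : P@_m = if m \in B then c m else 0 by rewrite /P mcoeff_sumX // andbT.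
exists P; split; first split.
- move=> m; rewrite PE; case: ifP => [Bm|_]; [left | by right].
  by apply: pi_unit; rewrite pic // unit_a //; case: ((memB m).1 Bm).
- apply/eqP; rewrite -subr_eq0; apply/eqP/separated => k.
  (* [Q] agrees with the series in degrees below [k], and with [P] up to the tails of the [alpha b];
     it mediates between the two values. *)
  pose Q := \sum_(b <- B) truncation (alpha b) k * 'X_[b].
  rewrite -[y](subrK Q.@[x]) -addrA; apply: mono_spanD.
    apply: is_sum_approx ay _ => m lt_mk; rewrite raddf_sum /=.
    have termE b : (truncation (alpha b) k * 'X_[b])@_m =
        if (b <= m)%MM && (beta m == b) then a m else 0.
      rewrite mcoeffMX_if; case: ifP => //= le; rewrite mcoeff_truncation.
      by rewrite (leq_ltn_trans (mdegB _ _) lt_mk) /alpha submK.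
    under eq_bigr do rewrite termE.
    have [am|am] := eqVneq (a m) 0; first by rewrite big1 // => b _; rewrite am if_same.
    have [Bb le] := betaP m am.
    rewrite (bigD1_seq (beta m)) //= le eqxx big1 ?addr0 // => b.
    by rewrite eq_sym => /negbTE ->; rewrite andbF.
  rewrite /Q /P !(raddf_sum (meval x)) -sumrB; apply: mono_span_sum => b /=.
  rewrite mevalM mevalZ -mulrBl -opprB mulNr; apply: mono_spanN.
  rewrite mulrC; apply: (mono_spanM (T1 := eq b)) (cP b k) => [_ m <-|].
    by rewrite mdegD => /leq_trans; apply; apply: leq_addl.
  by apply: mono_span_eval; apply: supp_inX.
- by move=> m; rewrite PE; case: ifP => [/memB[]//|_]; rewrite eqxx.
- by move=> m am minm; rewrite PE (memB m).2 ?pic //; apply/memB.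
Qed.

End CompleteLocal.

(** * Hensel lifting along a weight *)

Section Hensel.
Variables (S : comUnitRingType) (K : fieldType) (pi : {rmorphism S -> K}).
Variables (n : nat) (x : 'I_n -> S).
Hypothesis pi_surj : forall c, exists y, pi y = c.
Hypothesis pi_ker : forall y, pi y = 0 -> deg_ge x 1 y.
Hypothesis separated : forall y, (forall k, deg_ge x k y) -> y = 0.
Hypothesis complete : forall u : nat -> S, (forall k, deg_ge x k (u k.+1 - u k)) ->
  exists y, forall k, deg_ge x k (y - u k).

Lemma residue_lift (Q : {mpoly K[n]}) : exists L : {mpoly S[n]},
  (forall m, pi L@_m = Q@_m) /\ (forall m, Q@_m = 0 -> L@_m = 0).
Proof.
have [l lP] := choice pi_surj.
exists (\sum_(m <- msupp Q) l Q@_m *: 'X_[m]).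
have cE m : (\sum_(m <- msupp Q) l Q@_m *: 'X_[m])@_m = if Q@_m == 0 then 0 else l Q@_m.
  by rewrite (mcoeff_sumX predT (fun m => l Q@_m)) ?msupp_uniq // andbT mcoeff_msupp; case: eqP.
by split=> m; rewrite cE; case: eqP => [->|]; rewrite ?rmorph0.
Qed.

Variables (w : 'I_n -> nat) (S0 S1 S2 : 'X_{1..n} -> Prop) (G H : {mpoly K[n]}).
Variables (N1 N2 : nat) (P : {mpoly S[n]}).
Hypothesis w_gt0 : forall i, (0 < w i)%N.
Hypothesis S0_up : forall m m', S0 m -> S0 (m + m')%MM.
Hypothesis S12 : forall m1 m2, S1 m1 -> S2 m2 -> S0 (m1 + m2)%MM.
Hypothesis suppG : supp_in (fun m => S1 m /\ wt w m = N1) G.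
Hypothesis suppH : supp_in (fun m => S2 m /\ wt w m = N2) H.
Hypothesis decomp : forall N (D : {mpoly K[n]}), (N1 + N2 < N)%N ->
  supp_in (fun m => S0 m /\ wt w m = N) D ->
  exists A B, [/\ D = A * G + B * H,
    supp_in (fun m => S2 m /\ (wt w m + N1 = N)%N) A &
    supp_in (fun m => S1 m /\ (wt w m + N2 = N)%N) B].
Hypothesis suppP : supp_in (fun m => S0 m /\ (N1 + N2 <= wt w m)%N) P.
Hypothesis initP : forall m, wt w m = (N1 + N2)%N -> pi P@_m = (G * H)@_m.

(** The part of weight [N] has coefficients with zero residue, so it can be rewritten on larger
    exponents: these stay in [S0], which is closed upwards, and gain weight because [w] is
    positive. *)
Lemma raise_weight N (D : {mpoly S[n]}) :
  supp_in (fun m => S0 m /\ (N <= wt w m)%N) D ->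
  (forall m, wt w m = N -> pi D@_m = 0) ->
  mono_span x (fun m => S0 m /\ (N < wt w m)%N) D.@[x].
Proof.
move=> sD piD.
pose D1 : {mpoly S[n]} := \sum_(m <- msupp D | wt w m == N) D@_m *: 'X_[m].
have D1E m : D1@_m = if wt w m == N then D@_m else 0.
  rewrite /D1 (mcoeff_sumX (fun m => wt w m == N) (fun m => D@_m)) ?msupp_uniq // mcoeff_msupp.
  by case: (eqVneq D@_m 0) => [->|] /=; rewrite ?if_same.
rewrite -[D](subrK D1) mevalD; apply: mono_spanD.
  apply: mono_span_eval => m; rewrite mcoeffB D1E.
  case: (eqVneq (wt w m) N) => [_|ne]; first by rewrite subrr eqxx.
  by rewrite subr0 => /sD[Sm le]; rewrite ltn_neqAle eq_sym ne.
apply: mono_spanW (mono_span_ker pi_ker (T := fun m => S0 m /\ wt w m = N) _ _).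
- move=> _ [m1 [m2 [[Sm1 wm1] m2_gt0 ->]]]; split; first exact: S0_up.
  by rewrite wtD wm1 -addn1 leq_add2l; apply: leq_trans m2_gt0 (mdeg_le_wt _ w_gt0).
- move=> m; rewrite D1E; case: (eqVneq (wt w m) N) => [e|]; last by rewrite eqxx.
  by move=> /sD[].
- by move=> m; rewrite D1E; case: (eqVneq (wt w m) N) => [/piD|]; rewrite ?rmorph0.
Qed.

(** The upper bound [N + s] keeps [Q] disjoint from the next correction, of weight [N + s + 1].
    Coefficients are thus never modified once set, and the nonzero ones keep a nonzero residue. *)
Let approx s (Q : {mpoly S[n]}) (S' : 'X_{1..n} -> Prop) (Q0 : {mpoly K[n]}) N :=
  [/\ supp_in (fun m => S' m /\ (N <= wt w m <= N + s)%N) Q,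
      forall m, Q@_m != 0 -> pi Q@_m != 0 &
      forall m, (wt w m <= N)%N -> pi Q@_m = Q0@_m].

Let state := ({mpoly S[n]} * {mpoly S[n]})%type.
Let inv s (st : state) := [/\ approx s st.1 S1 G N1, approx s st.2 S2 H N2 &
  mono_span x (fun m => S0 m /\ (N1 + N2 + s < wt w m)%N) (P.@[x] - st.1.@[x] * st.2.@[x])].

Lemma approx_step s Q S' Q0 N M (B : {mpoly K[n]}) (L : {mpoly S[n]}) : approx s Q S' Q0 N ->
  supp_in (fun m => S' m /\ (wt w m + M = N + M + s.+1)%N) B ->
  (forall m, pi L@_m = B@_m) -> (forall m, B@_m = 0 -> L@_m = 0) ->
  approx s.+1 (Q + L) S' Q0 N /\ (forall m, (wt w m <= N + s)%N -> (Q + L)@_m = Q@_m).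
Proof.
move=> [sQ uQ iQ] sB LB L0.
have L0' m : (wt w m <= N + s)%N -> L@_m = 0.
  move=> le; apply: L0; apply/eqP/negPn/negP => /sB[_]; lia.
have Q0' m : (N + s < wt w m)%N -> Q@_m = 0.
  by move=> lt; apply/eqP/negPn/negP => /sQ[_]; lia.
have LB' m : L@_m != 0 -> B@_m != 0 by apply: contraNneq => /L0 ->.
split; last by move=> m le; rewrite mcoeffD L0' // addr0.
split=> [||m le]; last first.
- by rewrite mcoeffD L0' ?addr0 ?iQ //; lia.
- move=> m; rewrite mcoeffD; case: (leqP (wt w m) (N + s)) => [/L0'->|/Q0'->].
    by rewrite addr0 => /uQ.
  by rewrite add0r => /LB'; rewrite LB.
apply: supp_inD.
  by apply: supp_inW sQ => m [S'm le]; split=> //; lia.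
by move=> m /LB' /sB [S'm le]; split=> //; lia.
Qed.

(** With [A * G + B * H] the residue of the error in its lowest weight [N], the corrections lift [B]
    for the first factor and [A] for the second. In weight [N] the new error has residue zero: the
    factors reduce to [G] and [H] up to higher weight, and the product of the corrections has weight
    beyond [N]. *)
Lemma hensel_step s st : inv s st -> exists st', inv s.+1 st' /\
  forall m, ((wt w m <= N1 + s)%N -> st'.1@_m = st.1@_m) /\
            ((wt w m <= N2 + s)%N -> st'.2@_m = st.2@_m).
Proof.
case: st => Qg Qh [/= ag ah [D sD DE]].
pose N := (N1 + N2 + s.+1)%N.
pose D1 : {mpoly K[n]} := \sum_(m <- msupp D | wt w m == N) pi D@_m *: 'X_[m].
have D1E m : D1@_m = if wt w m == N then pi D@_m else 0.
  rewrite /D1 (mcoeff_sumX (fun m => wt w m == N) (fun m => pi D@_m)) ?msupp_uniq // mcoeff_msupp.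
  by case: (eqVneq D@_m 0) => [->|] //=; rewrite rmorph0 if_same.
have [||A [B [DAB sA sB]]] := decomp (N := N) (D := D1).
- by rewrite /N; lia.
- move=> m; rewrite D1E; case: (eqVneq (wt w m) N) => [e|]; last by rewrite eqxx.
  by move=> nz; split=> //; case: (sD m) => //; apply: contraNneq nz => ->; rewrite rmorph0.
have [LA [LAE LA0]] := residue_lift A; have [LB [LBE LB0]] := residue_lift B.
have [|ag' stabg] := approx_step (M := N2) ag _ LBE LB0.
  by apply: supp_inW sB => m [Sm e]; split=> //; rewrite e /N; lia.
have [|ah' stabh] := approx_step (M := N1) ah _ LAE LA0.
  by apply: supp_inW sA => m [Sm e]; split=> //; rewrite e /N; lia.
exists (Qg + LB, Qh + LA); split; last by move=> m; split; [exact: stabg | exact: stabh].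
split=> //=.
have suppLA : supp_in (fun m => S2 m /\ (wt w m + N1 = N)%N) LA.
  by move=> m nz; apply: sA; apply: contraNneq nz => /LA0 ->.
have suppLB : supp_in (fun m => S1 m /\ (wt w m + N2 = N)%N) LB.
  by move=> m nz; apply: sB; apply: contraNneq nz => /LB0 ->.
have [sg ug ig] := ag; have [sh uh ih] := ah.
have -> : P.@[x] - (Qg + LB).@[x] * (Qh + LA).@[x] = (D - LA * Qg - LB * Qh - LA * LB).@[x].
  rewrite !(mevalB, mevalD, mevalM) -DE; ring.
apply: mono_spanW (raise_weight (N := N) _ _).
- by move=> m [Sm le]; split=> //; move: le; rewrite /N; lia.
- have S21 m1 m2 : S2 m1 -> S1 m2 -> S0 (m1 + m2)%MM by rewrite addmC => ? ?; apply: S12.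
  apply: supp_inB; first apply: supp_inB; first apply: supp_inB.
  + by apply: supp_inW sD => m [Sm le]; split=> //; rewrite /N; lia.
  + apply: supp_inM suppLA sg => m1 m2 [? e1] [? e2]; split; first exact: S21.
    by rewrite wtD; lia.
  + apply: supp_inM suppLB sh => m1 m2 [? e1] [? e2]; split; first exact: S12.
    by rewrite wtD; lia.
  + apply: supp_inM suppLA suppLB => m1 m2 [? e1] [? e2]; split; first exact: S21.
    by rewrite wtD; rewrite /N in e1 e2 *; lia.
move=> m wm.
pose mp := @map_mpoly n _ _ pi.
have mpE (Q : {mpoly S[n]}) m' : pi Q@_m' = (mp Q)@_m' by rewrite mcoeff_map_mpoly.
have mpLA : mp LA = A by apply/mpolyP => q; rewrite -mpE.
have mpLB : mp LB = B by apply/mpolyP => q; rewrite -mpE.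
have mpB p q : mp (p - q) = mp p - mp q by exact: (rmorphB (map_mpoly pi)).
have mpM p q : mp (p * q) = mp p * mp q by exact: (rmorphM (map_mpoly pi)).
rewrite mpE !(mpB, mpM) mpLA mpLB.
have -> : (mp D - A * mp Qg - B * mp Qh - A * B)
  = mp D - (A * G + B * H) - A * (mp Qg - G) - B * (mp Qh - H) - A * B by ring.
rewrite -DAB !mcoeffB -mpE D1E wm eqxx subrr sub0r.
have vanish (U V : {mpoly K[n]}) NU NV : supp_in (fun m => wt w m + NU = N)%N U ->
    supp_in (fun m => NV < wt w m)%N V -> NU = NV -> (U * V)@_m = 0.
  move=> sU sV eN; apply/eqP/negPn/negP => nz.
  have : supp_in (fun m => N < wt w m)%N (U * V).
    apply: supp_inM sU sV => m1 m2 e1 e2; rewrite wtD; lia.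
  by move=> /(_ m nz); rewrite wm ltnn.
have sA' : supp_in (fun m => wt w m + N1 = N)%N A by apply: supp_inW sA => ? [].
have sB' : supp_in (fun m => wt w m + N2 = N)%N B by apply: supp_inW sB => ? [].
have above Q S' Q0 N' : approx s Q S' Q0 N' -> supp_in (fun m => N' < wt w m)%N (mp Q - Q0).
  move=> [_ _ iQ] q; rewrite mcoeffB -mpE ltnNge; apply: contraNN => /iQ ->.
  by rewrite subrr.
rewrite (vanish _ _ _ _ sA' (above _ _ _ _ ag)) // (vanish _ _ _ _ sB' (above _ _ _ _ ah)) //.
rewrite (vanish _ _ _ N1 sA') //; first by rewrite !subr0 oppr0.
by apply: supp_inW sB' => q; rewrite /N; lia.
Qed.

Lemma hensel : exists a b : 'X_{1..n} -> S, exists g h,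
  [/\ is_sum x a g, is_sum x b h & P.@[x] = g * h] /\
  [/\ forall m, a m != 0 -> [/\ pi (a m) != 0, S1 m & (N1 <= wt w m)%N],
      forall m, b m != 0 -> [/\ pi (b m) != 0, S2 m & (N2 <= wt w m)%N],
      forall m, wt w m = N1 -> pi (a m) = G@_m &
      forall m, wt w m = N2 -> pi (b m) = H@_m].
Proof.
have [LG [LGE LG0]] := residue_lift G; have [LH [LHE LH0]] := residue_lift H.
have approx0 (Q : {mpoly K[n]}) L S' N : supp_in (fun m => S' m /\ wt w m = N) Q ->
    (forall m, pi L@_m = Q@_m) -> (forall m, Q@_m = 0 -> L@_m = 0) -> approx 0 L S' Q N.
  move=> sQ LQ L0; have nzL m : L@_m != 0 -> Q@_m != 0 by apply: contraNneq => /L0 ->.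
  split=> // [m /nzL /sQ [? ->]|m /nzL]; last by rewrite LQ.
  by rewrite addn0 leqnn.
have ag := approx0 _ _ _ _ suppG LGE LG0; have ah := approx0 _ _ _ _ suppH LHE LH0.
have inv0 : inv 0 (LG, LH).
  split=> //=; rewrite addn0 -mevalM -mevalB.
  apply: raise_weight => [|m wm].
    apply: supp_inB => //; case: ag ah => sg _ _ [sh _ _].
    apply: supp_inM sg sh => m1 m2 [? /andP[le1 _]] [? /andP[le2 _]].
    by split; [exact: S12 | rewrite wtD leq_add].
  rewrite mcoeffB rmorphB initP // -(mcoeff_map_mpoly pi) rmorphM /=.
  have -> : map_mpoly pi LG = G by apply/mpolyP => q; rewrite mcoeff_map_mpoly; exact: LGE.
  have -> : map_mpoly pi LH = H by apply/mpolyP => q; rewrite mcoeff_map_mpoly; exact: LHE.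
  by rewrite subrr.
have ex_step (p : nat * state) : exists st', inv p.1 p.2 -> inv p.1.+1 st' /\
    forall m, ((wt w m <= N1 + p.1)%N -> st'.1@_m = p.2.1@_m) /\
              ((wt w m <= N2 + p.1)%N -> st'.2@_m = p.2.2@_m).
  have [/hensel_step [st' ?]|no] := pselect (inv p.1 p.2); first by exists st'.
  by exists p.2.
have [f fP] := choice ex_step.
pose st := fix st s := if s is s'.+1 then f (s', st s') else (LG, LH).
have stP s : inv s (st s) by elim: s => //= s IHs; case: (fP (s, st s)).
have stS s m : ((wt w m <= N1 + s)%N -> (st s.+1).1@_m = (st s).1@_m) /\
               ((wt w m <= N2 + s)%N -> (st s.+1).2@_m = (st s).2@_m).
  by case: (fP (s, st s)) => //= _; apply.
have stab s m : (wt w m <= s)%N -> (st s).1@_m = (st (wt w m)).1@_m /\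
    (st s).2@_m = (st (wt w m)).2@_m.
  move=> /subnK <-; elim: (s - wt w m)%N => // d [IH1 IH2]; rewrite addSn.
  by case: (stS (d + wt w m)%N m) => e1 e2; rewrite e1 ?e2 ?IH1 ?IH2 //; lia.
(* The coefficients at [m] are final from stage [wt w m] on, so the diagonal choice defines the
   limit series. *)
pose a m := (st (wt w m)).1@_m; pose b m := (st (wt w m)).2@_m.
have [g ga] := sum_exists complete a; have [h hb] := sum_exists complete b.
exists a, b, g, h; split; split=> //.
- apply/eqP; rewrite -subr_eq0; apply/eqP/separated => k.
  (* Exponents of degree below [k] have weight at most [s]. Hence stage [s] has the final
     coefficients in these degrees, and its error, of weight above [s], has degree at least [k]. *)
  pose s := ((\sum_i w i) * k)%N.
  have le_s m : (mdeg m < k)%N -> (wt w m <= s)%N.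
    by move=> lt; apply: leq_trans (wt_le_mdeg _ _) _; rewrite leq_mul2l ltnW ?orbT.
  have [_ _ errs] := stP s.
  have -> : P.@[x] - g * h = (P.@[x] - (st s).1.@[x] * (st s).2.@[x])
     - ((g - (st s).1.@[x]) * (st s).2.@[x] + g * (h - (st s).2.@[x])) by ring.
  apply: mono_spanB.
    apply: mono_spanW errs => m [_ lt]; rewrite leqNgt; apply/negP => /le_s; lia.
  apply: mono_spanD; [rewrite mulrC|]; apply: mono_spanZ.
    by apply: is_sum_approx ga _ => m /le_s /stab [].
  by apply: is_sum_approx hb _ => m /le_s /stab [].
- move=> m nz; have [[sg ug _] _ _] := stP (wt w m).
  by have [? /andP[]] := sg m nz; split=> //; exact: ug.
- move=> m nz; have [_ [sh uh _] _] := stP (wt w m).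
  by have [? /andP[]] := sh m nz; split=> //; exact: uh.
- by move=> m e; have [[_ _ ig] _ _] := stP (wt w m); apply: ig; rewrite e.
- by move=> m e; have [_ [_ _ ih] _] := stP (wt w m); apply: ih; rewrite e.
Qed.

End Hensel.

(** * Primitive directions *)

Section PrimitiveVector.
Variable n : nat.

Definition collinear (d c : 'I_n -> int) := forall i j, d i * c j = d j * c i.

(** Choose [c] collinear with [d] with the least positive absolute value at [i0]. Euclidean division
    at [i0] leaves a collinear vector with a smaller entry there; that entry is zero by minimality,
    hence so is the vector. *)
Lemma primitive_vector (d : 'I_n -> int) i0 : d i0 != 0 ->
  exists c : 'I_n -> int, [/\ c i0 != 0, collinear d c &
    forall d', collinear d' c -> exists q, forall i, d' i = q * c i].
Proof.
move=> d0.
pose size_at a := (0 < a)%N && `[< exists2 c, collinear c d & absz (c i0) = a >].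
have ex : exists a, size_at a.
  exists (absz (d i0)); rewrite /size_at absz_gt0 d0; apply/asboolP.
  by exists d => // i j; rewrite mulrC.
case: (ex_minnP ex) => a /andP[a_gt0 /asboolP[c cd ca]] mina.
have c0 : c i0 != 0 by rewrite -absz_gt0 ca.
exists c; split=> // [i j|d' d'c]; first by rewrite mulrC -cd mulrC.
pose q := (d' i0 %/ c i0)%Z; exists q.
have d'd : collinear (fun i => d' i - q * c i) d.
  have e i : c i0 * (d' i - q * c i) = (d' i0 - q * c i0) * c i.
    by rewrite mulrBr [c i0 * d' i]mulrC d'c; ring.
  by move=> i j; apply: (mulfI c0); rewrite !mulrA !e -!mulrA cd.
have r0 : d' i0 - q * c i0 = 0.
  apply/eqP; apply: contraT => r_neq0.
  have : size_at (absz (d' i0 - q * c i0)%R).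
    rewrite /size_at absz_gt0 r_neq0; apply/asboolP.
    by exists (fun i => d' i - q * c i).
  move=> /mina; rewrite leqNgt -ca => /negP[].
  have -> : d' i0 - q * c i0 = (d' i0 %% c i0)%Z by have := divz_eq (d' i0) (c i0); rewrite /q; lia.
  have := modz_ge0 (d' i0) c0; have := ltz_mod (d' i0) c0.
  by lia.
move=> i; apply/eqP; rewrite -subr_eq0; have := d'd i i0; rewrite r0 mul0r => /eqP.
by rewrite mulf_eq0 (negbTE d0) orbF.
Qed.


End PrimitiveVector.

Section PrimitiveDirection.
Variable n : nat.

Lemma wt_subz (w : 'I_n -> nat) (m m' : 'X_{1..n}) :
  (wt w m)%:Z - (wt w m')%:Z = \sum_i (w i)%:Z * ((m i)%:Z - (m' i)%:Z).
Proof.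
rewrite /wt !(big_morph Posz PoszD (erefl _)) -sumrB.
by apply: eq_bigr => i _; rewrite !PoszM mulrBr.
Qed.

Variables (cp cm : 'X_{1..n}).
Let c i := (cp i)%:Z - (cm i)%:Z.
Hypothesis disj : forall i, cp i = 0%N \/ cm i = 0%N.
Hypothesis cp_neq0 : exists i, (0 < cp i)%N.
Hypothesis cm_neq0 : exists i, (0 < cm i)%N.

(** The extreme rays give equality where [c] vanishes and the 2 x 2 minors for coordinates of
    opposite sign. The other minors follow by passing through the reference coordinates [i0] and
    [j0]. *)
Lemma bal_eq_collinear m m' : bal_eq cp cm m m' ->
  collinear (fun i => (m' i)%:Z - (m i)%:Z) c.
Proof.
move=> mm'.
have le : bal_le cp cm m m' by move=> w /mm' ->.
have ge : bal_le cp cm m' m by move=> w /mm' ->.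
have [i0 cpi0] := cp_neq0; have [j0 cmj0] := cm_neq0.
have zero i : cp i = 0%N -> cm i = 0%N -> m i = m' i.
  by move=> p z; apply/eqP; rewrite eqn_leq !(bal_le_zero _ p z).
have ray i j : (0 < cp i)%N -> (0 < cm j)%N ->
    ((m' i)%:Z - (m i)%:Z) * c j = ((m' j)%:Z - (m j)%:Z) * c i.
  move=> p q; have := bal_le_ray disj le p q; have := bal_le_ray disj ge p q.
  rewrite /c; have -> : cp j = 0%N by case: (disj j) q => // ->.
  have -> : cm i = 0%N by case: (disj i) p => // ->.
  by nia.
have ref i : ((m' i)%:Z - (m i)%:Z) * c j0 = ((m' j0)%:Z - (m j0)%:Z) * c i.
  have [cpi|cpi] := posnP (cp i); last exact: ray.
  have [cmi|cmi] := posnP (cm i); first by rewrite zero // /c cpi cmi !subrr mulr0 mul0r.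
  have ci0 : c i0 != 0.
    by rewrite /c; case: (disj i0) cpi0 => -> //; rewrite subr0; lia.
  apply: (mulfI ci0); rewrite mulrC -mulrA [c j0 * _]mulrC mulrA -(ray i0 i cpi0 cmi).
  by rewrite mulrAC (ray i0 j0 cpi0 cmj0); ring.
have cj0 : c j0 != 0 by rewrite /c; case: (disj j0) cmj0 => -> //; rewrite sub0r oppr_eq0; lia.
by move=> i j; apply: (mulfI cj0); rewrite !mulrA ![c j0 * _]mulrC !ref; ring.
Qed.

Lemma positive_balanced_weight :
  exists2 w : 'I_n -> nat, (forall i, 0 < w i)%N & wt w cp = wt w cm.
Proof.
have sum_gt0 (q : 'X_{1..n}) : (exists i, (0 < q i)%N) -> (0 < \sum_i q i)%N.
  by move=> [i qi]; rewrite (bigD1 i) //= ltn_addr.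
(* With these values both [cp] and [cm] get the weight [(\sum_i cp i) * (\sum_i cm i)]. *)
exists (fun i => if cp i != 0%N then \sum_j cm j else if cm i != 0%N then \sum_j cp j else 1)%N.
  by move=> i; case: ifP => _; [exact: sum_gt0 | case: ifP => _ //; exact: sum_gt0].
rewrite /wt [LHS](_ : _ = (\sum_i (\sum_j cm j) * cp i)%N); last first.
  by apply: eq_bigr => i _; case: eqVneq => // ->; rewrite !muln0.
rewrite [RHS](_ : _ = (\sum_i (\sum_j cp j) * cm i)%N); last first.
  apply: eq_bigr => i _; case: (eqVneq (cm i) 0%N) => [->|cmi]; first by rewrite !muln0.
  by case: (disj i) => e; [rewrite e | rewrite e in cmi].
by rewrite -!big_distrr /= mulnC.
Qed.

Lemma bal_le_eq w a m : (forall i, 0 < w i)%N -> wt w cp = wt w cm ->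
  bal_le cp cm a m -> wt w m = wt w a -> bal_eq cp cm a m.
Proof.
move=> w_gt0 wbal am wm v vbal; apply/eqP; rewrite eqn_leq am //=.
(* a large multiple of [w] dominates [v], and the difference is again balanced *)
pose N := (\sum_i v i)%N; pose u i := (N * w i - v i)%N.
have uE q : (wt u q + wt v q = N * wt w q)%N.
  rewrite /wt -big_split big_distrr; apply: eq_bigr => i _ /=.
  rewrite -mulnDl mulnA subnK //; apply: leq_trans (leq_pmulr _ (w_gt0 i)).
  by rewrite /N (bigD1 i) //= leq_addr.
have ubal : wt u cp = wt u cm by have := uE cp; have := uE cm; rewrite vbal wbal; lia.
by have := am u ubal; have := uE a; have := uE m; rewrite wm; lia.
Qed.

End PrimitiveDirection.

Lemma direction_exists n (m0 m1 : 'X_{1..n}) : m0 != m1 ->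
  exists cp cm : 'X_{1..n},
  [/\ forall i, cp i = 0%N \/ cm i = 0%N,
      collinear (fun i => (m1 i)%:Z - (m0 i)%:Z) (fun i => (cp i)%:Z - (cm i)%:Z),
      exists i, cp i != cm i &
      forall d, collinear d (fun i => (cp i)%:Z - (cm i)%:Z) ->
        exists q, forall i, d i = q * ((cp i)%:Z - (cm i)%:Z)].
Proof.
move=> ne; have [i0 d0] : exists i, (m1 i)%:Z - (m0 i)%:Z != 0 :> int.
  apply: contrapT => no; case/eqP: ne; apply/mnmP => i.
  by apply/eqP/negPn/negP => ne_i; apply: no; exists i; move: ne_i; lia.
have [c [c0 dc prim]] := primitive_vector (d := fun i => (m1 i)%:Z - (m0 i)%:Z) d0.
pose cp := [multinom (if (0 <= c i)%R then absz (c i) else 0%N) | i < n].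
pose cm := [multinom (if (0 <= c i)%R then 0%N else absz (c i)) | i < n].
have cE i : (cp i)%:Z - (cm i)%:Z = c i.
  by rewrite !mnmE; case: ifP => /=; lia.
exists cp, cm; split.
- by move=> i; rewrite !mnmE; case: ifP; [right | left].
- by move=> i j; rewrite !cE.
- by exists i0; apply: contraNneq c0 => e; rewrite -cE e subrr.
- move=> d dc'; have [|q qP] := prim d; first by move=> i j; rewrite -!cE.
  by exists q => i; rewrite cE.
Qed.

(** * Faces of Newton polyhedra *)

Section NewtonFaces.
Variables (Rr : realType) (n : nat) (S : comRingType) (P : {mpoly S[n]}).
Implicit Types (xi p q : 'rV[Rr]_n) (m : 'X_{1..n}).

Lemma dotp_wt (w : 'I_n -> nat) m :
  dotp (\row_i ((w i)%:R : Rr)) (mvec Rr m) = (wt w m)%:R.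
Proof.
rewrite /dotp /wt natr_sum; apply: eq_bigr => i _.
by rewrite !mxE natrM.
Qed.

Lemma dotpD xi p q : dotp xi (p + q) = dotp xi p + dotp xi q.
Proof. by rewrite /dotp -big_split; apply: eq_bigr => i _; rewrite mxE mulrDr. Qed.

Lemma dotpZ xi (s : Rr) p : dotp xi (s *: p) = s * dotp xi p.
Proof. by rewrite /dotp mulr_sumr; apply: eq_bigr => i _; rewrite mxE mulrCA. Qed.

Lemma dotpDl xi xi' p : dotp (xi + xi') p = dotp xi p + dotp xi' p.
Proof. by rewrite /dotp -big_split; apply: eq_bigr => i _; rewrite mxE mulrDl. Qed.

Lemma dotpZl (s : Rr) xi p : dotp (s *: xi) p = s * dotp xi p.
Proof. by rewrite /dotp mulr_sumr; apply: eq_bigr => i _; rewrite mxE mulrA. Qed.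

Lemma mvecD m m' : mvec Rr (m + m')%MM = mvec Rr m + mvec Rr m'.
Proof. by apply/rowP => i; rewrite !mxE mnmDE natrD. Qed.

Lemma mvecMn m k : mvec Rr (m *+ k)%MM = k%:R *: mvec Rr m.
Proof. by apply/rowP => i; rewrite !mxE mulmnE natrM mulrC. Qed.

Lemma newton_monomial m : P@_m != 0 -> newton P (mvec Rr m).
Proof.
rewrite -mcoeff_msupp => mP; exists (fun m' => (m' == m)%:R); split=> [m'||i].
- by rewrite ler0n.
- by rewrite (bigD1_seq m) //= eqxx big1 ?addr0 // => m' /negbTE ->.
- rewrite (bigD1_seq m) //= eqxx mul1r big1 ?addr0 // => m' /negbTE ->.
  by rewrite mul0r.
Qed.

Lemma newton_up p q : newton P p -> (forall i, p ord0 i <= q ord0 i) -> newton P q.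
Proof.
move=> [w [w0 w1 wp]] pq; exists w; split=> // i.
exact: le_trans (wp i) (pq i).
Qed.

Lemma newton_convex p q (t : Rr) : 0 <= t <= 1 -> newton P p -> newton P q ->
  newton P ((1 - t) *: p + t *: q).
Proof.
move=> /andP[t0 t1] [u [u0 u1 up]] [v [v0 v1 vq]].
have t1' : 0 <= 1 - t by rewrite subr_ge0.
exists (fun m => (1 - t) * u m + t * v m); split=> [m||i].
- by rewrite addr_ge0 // mulr_ge0.
- by rewrite big_split /= -!mulr_sumr u1 v1 !mulr1 subrK.
rewrite (eq_bigr (fun m => (1 - t) * (u m * mvec Rr m ord0 i) + t * (v m * mvec Rr m ord0 i))).
  by rewrite big_split /= -!mulr_sumr !mxE lerD // ler_wpM2l.
by move=> m _; rewrite mulrDl !mulrA.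
Qed.

Lemma dotp_comb xi (w : 'X_{1..n} -> Rr) p :
  dotp xi p = \sum_(m <- msupp P) w m * dotp xi (mvec Rr m) +
    \sum_i xi ord0 i * (p ord0 i - \sum_(m <- msupp P) w m * mvec Rr m ord0 i).
Proof.
rewrite (eq_bigr (fun m => \sum_i w m * (xi ord0 i * mvec Rr m ord0 i))); last first.
  by move=> m _; rewrite mulr_sumr.
rewrite exchange_big -big_split /dotp; apply: eq_bigr => i _ /=.
rewrite mulrBr mulr_sumr addrC -addrA [X in _ + X](_ : _ = 0) ?addr0 //.
by rewrite addrC -sumrB big1 // => m _; rewrite mulrCA subrr.
Qed.

Lemma newton_dotp xi (c : Rr) p : (forall i, 0 <= xi ord0 i) ->
  (forall m, P@_m != 0 -> c <= dotp xi (mvec Rr m)) -> newton P p -> c <= dotp xi p.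
Proof.
move=> xi0 cP [w [w0 w1 wp]]; rewrite (dotp_comb xi w) -[c]addr0 lerD //.
  rewrite -[c]mul1r -w1 mulr_suml !big_seq ler_sum // => m.
  by rewrite mcoeff_msupp => /cP; apply: ler_wpM2l.
by rewrite sumr_ge0 // => i _; rewrite mulr_ge0 // subr_ge0.
Qed.

(** The excess of the exponents over [c] and the slack of [p] over their combination are both
    nonnegative with total at most 0. So both vanish term by term, the slack because every
    coordinate of [xi] is positive. *)
Lemma newton_face_comb xi (c : Rr) p : (forall i, 0 < xi ord0 i) ->
  (forall m, P@_m != 0 -> c <= dotp xi (mvec Rr m)) -> newton P p -> dotp xi p <= c ->
  exists w : 'X_{1..n} -> Rr, [/\ forall m, 0 <= w m, \sum_(m <- msupp P) w m = 1,
    forall m, P@_m != 0 -> w m != 0 -> dotp xi (mvec Rr m) = c &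
    forall i, p ord0 i = \sum_(m <- msupp P) w m * mvec Rr m ord0 i].
Proof.
move=> xi0 cP [w [w0 w1 wp]] pc; exists w.
have slack i : 0 <= xi ord0 i * (p ord0 i - \sum_(m <- msupp P) w m * mvec Rr m ord0 i).
  by rewrite mulr_ge0 ?subr_ge0 // ltW.
have excess m : 0 <= (if P@_m != 0 then w m * (dotp xi (mvec Rr m) - c) else 0).
  by case: ifP => // nz; rewrite mulr_ge0 // subr_ge0 cP.
have excessE : \sum_(m <- msupp P) (if P@_m != 0 then w m * (dotp xi (mvec Rr m) - c) else 0) =
    \sum_(m <- msupp P) w m * dotp xi (mvec Rr m) - c.
  rewrite -[X in _ = _ - X]mul1r -w1 mulr_suml -sumrB !big_seq; apply: eq_bigr => m.
  by rewrite mcoeff_msupp => ->; rewrite mulrBr.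
have tot := dotp_comb xi w p.
have e1 : 0 <= \sum_(m <- msupp P) (if P@_m != 0 then w m * (dotp xi (mvec Rr m) - c) else 0).
  by rewrite sumr_ge0.
have e2 : 0 <= \sum_i xi ord0 i * (p ord0 i - \sum_(m <- msupp P) w m * mvec Rr m ord0 i).
  by rewrite sumr_ge0.
have z1 : \sum_(m <- msupp P) (if P@_m != 0 then w m * (dotp xi (mvec Rr m) - c) else 0) = 0.
  by move: excessE tot e1 e2 pc; lra.
have z2 : \sum_i xi ord0 i * (p ord0 i - \sum_(m <- msupp P) w m * mvec Rr m ord0 i) = 0.
  by move: excessE tot e1 e2 pc; lra.
split=> // [m nz wm|i].
  move/eqP: z1; rewrite psumr_eq0 // => /allP /(_ m).
  rewrite mcoeff_msupp nz /= => /(_ isT); rewrite mulf_eq0 (negbTE wm) /= subr_eq0.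
  by move/eqP.
move/eqP: z2; rewrite psumr_eq0 // => /allP /(_ i (mem_index_enum _)) /=.
by rewrite mulf_eq0 gt_eqF //= subr_eq0 => /eqP.
Qed.

Lemma compact_face xi : (forall i, 0 < xi ord0 i) -> (exists m, P@_m != 0) ->
  compact_pts (face_at (newton P) xi).
Proof.
move=> xi0 [m0 P0]; rewrite -mcoeff_msupp in P0.
have [m1 P1 min1] := seq_argmin (fun m => dotp xi (mvec Rr m)) P0.
rewrite mcoeff_msupp in P1.
have min1' m : P@_m != 0 -> dotp xi (mvec Rr m1) <= dotp xi (mvec Rr m).
  by rewrite -mcoeff_msupp => /min1.
exists (\sum_(m <- msupp P) \sum_i mvec Rr m ord0 i) => p [Np minp] i.
have [w [w0 w1 _ pE]] := newton_face_comb xi0 min1' Np (minp _ (newton_monomial P1)).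
have mv0 m j : 0 <= mvec Rr m ord0 j by rewrite mxE ler0n.
have w_le1 m : m \in msupp P -> w m <= 1.
  by move=> mP; rewrite -w1 (bigD1_seq m) //= lerDl sumr_ge0.
rewrite ger0_norm pE; last by rewrite sumr_ge0 // => m _; rewrite mulr_ge0.
rewrite !big_seq ler_sum // => m mP.
rewrite (bigD1 i) //= -[X in X <= _]addr0 lerD ?sumr_ge0 //.
by rewrite -[X in _ <= X]mul1r ler_wpM2r // w_le1.
Qed.

(** The parameter [s] counts, with real values, the steps from the [cm] end to the [cp] end. A point
    of the face is a combination of minimal exponents, and its [s] is the weighted mean of their
    indices [j]; conversely both ends are exponents of [P]. *)
Lemma face_segment xi (e cp cm : 'X_{1..n}) k : (forall i, 0 < xi ord0 i) ->
  dotp xi (mvec Rr cp) = dotp xi (mvec Rr cm) ->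
  (forall m, P@_m != 0 -> dotp xi (mvec Rr (e + cm *+ k)%MM) <= dotp xi (mvec Rr m)) ->
  (forall m, P@_m != 0 -> dotp xi (mvec Rr m) = dotp xi (mvec Rr (e + cm *+ k)%MM) ->
     exists2 j, (j <= k)%N & m = (e + hmono cp cm k j)%MM) ->
  P@_(e + cm *+ k) != 0 -> P@_(e + cp *+ k) != 0 ->
  forall p, face_at (newton P) xi p <-> exists2 s, 0 <= s <= k%:R &
    p = mvec Rr e + s *: mvec Rr cp + (k%:R - s) *: mvec Rr cm.
Proof.
move=> xi0 bal minP lineP Pa Pb p; split.
  move=> [Np minp].
  have [w [w0 w1 wmin pE]] := newton_face_comb xi0 minP Np (minp _ (newton_monomial Pa)).
  have ex_j m : exists j, P@_m != 0 -> w m != 0 -> (j <= k)%N /\ m = (e + hmono cp cm k j)%MM.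
    have [[nz wm]|no] := pselect (P@_m != 0 /\ w m != 0).
      by have [j jk mE] := lineP m nz (wmin m nz wm); exists j.
    by exists 0%N => nz wm; case: no.
  have [j jP] := choice ex_j.
  have wE (m : 'X_{1..n}) : m \in msupp P -> w m <> 0 ->
      (j m <= k)%N /\ m = (e + hmono cp cm k (j m))%MM.
    by rewrite mcoeff_msupp => nz /eqP; apply: jP.
  have wsum (c : Rr) : c = \sum_(m <- msupp P) w m * c by rewrite -mulr_suml w1 mul1r.
  exists (\sum_(m <- msupp P) w m * (j m)%:R).
    apply/andP; split; first by rewrite sumr_ge0 // => m _; rewrite mulr_ge0.
    rewrite [X in _ <= X]wsum !big_seq ler_sum // => m mP.
    have [->|/eqP wm] := eqVneq (w m) 0; first by rewrite !mul0r.
    by rewrite ler_wpM2l // ler_nat; case: (wE m mP wm).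
  apply/rowP => i; rewrite pE !mxE.
  rewrite [(e i)%:R]wsum [X in (X - _) * _]wsum -sumrB !mulr_suml -!big_split /= !big_seq.
  apply: eq_bigr => m mP.
  have [->|/eqP wm] := eqVneq (w m) 0; first by rewrite !mul0r subr0 mul0r !addr0.
  have [jk mE] := wE m mP wm.
  rewrite mxE {2}mE mnmDE hmonoE !natrD !natrM natrB //; ring.
move=> [s /andP[s0 sk] ->].
have dE : dotp xi (mvec Rr e + s *: mvec Rr cp + (k%:R - s) *: mvec Rr cm)
    = dotp xi (mvec Rr (e + cm *+ k)%MM).
  by rewrite mvecD mvecMn !dotpD !dotpZ bal; ring.
split; last first.
  move=> q Nq; rewrite dE; apply: newton_dotp Nq => // i.
  exact: ltW.
(* For [k = 0] division by zero gives 0 and [s = 0]: the segment is a point, as happens when a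
   factor is a monomial. *)
have tk : s / k%:R * k%:R = s.
  have [k0|k0] := eqVneq k 0%N; last by rewrite divfK // pnatr_eq0.
  have -> : s = 0 by apply/eqP; rewrite eq_le s0 andbT; rewrite k0 in sk.
  by rewrite !mul0r.
have -> : mvec Rr e + s *: mvec Rr cp + (k%:R - s) *: mvec Rr cm =
    (1 - s / k%:R) *: mvec Rr (e + cm *+ k)%MM + (s / k%:R) *: mvec Rr (e + cp *+ k)%MM.
  rewrite !mvecD !mvecMn; apply/rowP => i; rewrite !mxE.
  by rewrite -{1 2}tk; ring.
apply: newton_convex; try exact: newton_monomial.
rewrite divr_ge0 ?ler0n //=; have [->|k0] := eqVneq k 0%N; first by rewrite invr0 mulr0 ler01.
by rewrite ler_pdivrMr ?mul1r // ltr0n lt0n.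
Qed.

End NewtonFaces.

(** To split a point of parameter [s], the first [k1] units go to [E1] and the remainder to [E2]. *)
Lemma minkowski_segments (Rr : realType) n (e p q : 'rV[Rr]_n) (k1 k2 : nat) E E1 E2 :
  (forall a, E a <-> exists2 s, 0 <= s <= (k1 + k2)%:R &
     a = e + s *: p + ((k1 + k2)%:R - s) *: q) ->
  (forall a, E1 a <-> exists2 s, 0 <= s <= k1%:R & a = s *: p + (k1%:R - s) *: q) ->
  (forall a, E2 a <-> exists2 s, 0 <= s <= k2%:R & a = e + s *: p + (k2%:R - s) *: q) ->
  minkowski_eq E E1 E2.
Proof.
move=> EP E1P E2P a; split.
  move=> /EP[s /andP[s0]]; rewrite natrD => sk aE.
  have [le|lt] := leP s k1%:R.
    exists (s *: p + (k1%:R - s) *: q), (e + 0 *: p + (k2%:R - 0) *: q); split.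
    - by apply/E1P; exists s; rewrite // s0.
    - by apply/E2P; exists 0; rewrite // lexx ler0n.
    - by rewrite aE; apply/rowP => i; rewrite !mxE; ring.
  exists (k1%:R *: p + (k1%:R - k1%:R) *: q),
    (e + (s - k1%:R) *: p + (k2%:R - (s - k1%:R)) *: q); split.
  - by apply/E1P; exists k1%:R; rewrite // lexx ler0n.
  - by apply/E2P; exists (s - k1%:R) => //; move: lt sk; lra.
  - by rewrite aE; apply/rowP => i; rewrite !mxE; ring.
move=> [b [c [/E1P[s1 h1 ->] /E2P[s2 h2 ->] ->]]]; apply/EP; exists (s1 + s2).
  by rewrite natrD; move: h1 h2; lra.
by rewrite natrD; apply/rowP => i; rewrite !mxE; ring.
Qed.

(** * Loose edges and balanced weights *)

Section LooseEdge.
Variables (Rr : realType) (n : nat).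
Implicit Types (A : 'rV[Rr]_n -> Prop) (m : 'X_{1..n}).

Lemma dim_ge2_minor A (q0 q1 q2 : 'rV[Rr]_n) i j : A q0 -> A q1 -> A q2 ->
  (q1 - q0) ord0 i * (q2 - q0) ord0 j != (q1 - q0) ord0 j * (q2 - q0) ord0 i ->
  dim_ge A 2.
Proof.
move=> A0 A1 A2 minor.
exists (fun t : 'I_3 => if t == 0 :> nat then q0 else if t == 1 :> nat then q1 else q2).
split; first by move=> t; case: ifP => // _; case: ifP.
apply: inj_row_free => v v0.
have vE l : v ord0 ord0 * (q1 - q0) ord0 l + v ord0 (lift ord0 ord0) * (q2 - q0) ord0 l = 0.
  have := congr1 (fun M : 'rV[Rr]_n => M ord0 l) v0.
  by rewrite !mxE !big_ord_recl big_ord0 !mxE /= addr0.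
have := vE i; have := vE j.
move: minor; rewrite -subr_eq0.
move: ((q1 - q0) ord0 i) ((q1 - q0) ord0 j) ((q2 - q0) ord0 i) ((q2 - q0) ord0 j).
move=> a b c d det ej ei.
have v0E : v ord0 ord0 = 0.
  apply: (mulIf det); rewrite mul0r.
  have -> : v ord0 ord0 * (a * d - b * c) = d * (v ord0 ord0 * a + v ord0 (lift ord0 ord0) * c)
     - c * (v ord0 ord0 * b + v ord0 (lift ord0 ord0) * d) by ring.
  by rewrite ei ej !mulr0 subr0.
have v1E : v ord0 (lift ord0 ord0) = 0.
  apply: (mulIf det); rewrite mul0r.
  have -> : v ord0 (lift ord0 ord0) * (a * d - b * c) =
     a * (v ord0 ord0 * b + v ord0 (lift ord0 ord0) * d)
     - b * (v ord0 ord0 * a + v ord0 (lift ord0 ord0) * c) by ring.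
  by rewrite ei ej !mulr0 subr0.
apply/rowP => t; rewrite mxE; case: (unliftP ord0 t) => [u ->|->] //.
by rewrite [u]ord1.
Qed.

Variables (S : comRingType) (P : {mpoly S[n]}) (E : 'rV[Rr]_n -> Prop).
Let X (xi : 'rV[Rr]_n) m := dotp xi (mvec Rr m).

(** If [xi] vanished at [i], the face would be stable under increasing the [i]-th coordinate, hence
    unbounded. *)
Lemma compact_face_pos (xi : 'rV[Rr]_n) : (forall i, 0 <= xi ord0 i) ->
  (exists p, face_at (newton P) xi p) -> compact_pts (face_at (newton P) xi) ->
  forall i, 0 < xi ord0 i.
Proof.
move=> xi0 [p [Np minp]] [M bdM] i; rewrite lt_neqAle xi0 andbT eq_sym.
apply/eqP => xii.
pose t := `|M| + `|p ord0 i| + 1.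
have t0 : 0 <= t by rewrite !addr_ge0 // ler01.
pose p' := p + \row_l (t * (l == i)%:R).
have p'i : p' ord0 i = p ord0 i + t by rewrite !mxE eqxx mulr1.
have : face_at (newton P) xi p'.
  split; first by apply: newton_up Np _ => l; rewrite !mxE lerDl mulr_ge0 // ler0n.
  move=> b /minp; rewrite dotpD [X in _ + X](_ : _ = 0) ?addr0 //.
  rewrite /dotp (bigD1 i) //= xii mul0r add0r big1 // => l /negbTE ne.
  by rewrite !mxE ne !mulr0.
move=> /bdM /(_ i); rewrite p'i; apply/negP; rewrite -ltNge.
have := ler_norm M; have := ler_norm (p ord0 i + t); have := ler_norm (- p ord0 i).
by rewrite normrN /t; lra.
Qed.

Definition same_line (m0 m1 m : 'X_{1..n}) :=
  collinear (fun i => (m i)%:Z - (m0 i)%:Z) (fun i => (m1 i)%:Z - (m0 i)%:Z).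

Lemma minor_same_line m0 m1 m : (forall i j,
  (mvec Rr m1 - mvec Rr m0) ord0 i * (mvec Rr m - mvec Rr m0) ord0 j =
  (mvec Rr m1 - mvec Rr m0) ord0 j * (mvec Rr m - mvec Rr m0) ord0 i) ->
  same_line m0 m1 m.
Proof.
move=> minor i j; have cast q l :
    (mvec Rr q - mvec Rr m0) ord0 l = ((q l)%:Z - (m0 l)%:Z)%:~R by rewrite !mxE intrB.
have := minor j i; rewrite !cast -!intrM => /eqP; rewrite eqr_int => /eqP.
by rewrite mulrC => ->; rewrite mulrC.
Qed.

Lemma same_line_wt (w : 'I_n -> nat) m0 m1 m : m0 != m1 -> same_line m0 m1 m ->
  wt w m0 = wt w m1 -> wt w m = wt w m0.
Proof.
move=> ne sl wm; have [j dj] : exists j, (m1 j)%:Z - (m0 j)%:Z != 0 :> int.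
  apply: contrapT => no; case/eqP: ne; apply/mnmP => j.
  by apply/eqP/negPn/negP => ne_j; apply: no; exists j; move: ne_j; lia.
apply/eqP; rewrite -eqz_nat -subr_eq0 wt_subz; rewrite -(inj_eq (mulIf dj)) mul0r.
rewrite mulr_suml.
rewrite (eq_bigr (fun i => ((m j)%:Z - (m0 j)%:Z) * ((w i)%:Z * ((m1 i)%:Z - (m0 i)%:Z)))).
  by rewrite -mulr_sumr -wt_subz wm subrr mulr0.
by move=> i _; rewrite -mulrA sl; ring.
Qed.

Lemma loose_edge_structure : loose_edge (newton P) E ->
  exists (xi : 'rV[Rr]_n) m0 m1, [/\ forall i, 0 < xi ord0 i,
    forall p, E p <-> face_at (newton P) xi p,
    [/\ P@_m0 != 0, m0 != m1 & X xi m0 = X xi m1],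
    forall m, P@_m != 0 -> X xi m0 <= X xi m /\ (X xi m = X xi m0 -> same_line m0 m1 m) &
    forall w : 'I_n -> nat, wt w m0 = wt w m1 -> forall m, P@_m != 0 -> (wt w m0 <= wt w m)%N].
Proof.
move=> [[[xi [xi_ge0 EP]] [dE1 ndE2]] cE loose].
have [p [Ep p_free]] := dE1.
have Fp t : face_at (newton P) xi (p t) by apply/EP.
have xi0 : forall i, 0 < xi ord0 i.
  apply: compact_face_pos => //; first by exists (p ord0).
  by case: cE => M bdM; exists M => a /EP; apply: bdM.
have xi0W i : 0 <= xi ord0 i by exact: ltW.
pose c0 := dotp xi (p ord0).
have minS m : P@_m != 0 -> c0 <= X xi m.
  by move=> /(newton_monomial Rr); case: (Fp ord0) => _; apply.
have combF q : face_at (newton P) xi q -> exists w : 'X_{1..n} -> Rr,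
    [/\ forall m, 0 <= w m, \sum_(m <- msupp P) w m = 1,
    forall m, P@_m != 0 -> w m != 0 -> X xi m = c0 &
    forall i, q ord0 i = \sum_(m <- msupp P) w m * mvec Rr m ord0 i].
  move=> [Nq minq]; apply: newton_face_comb => //.
  by apply: minq; case: (Fp ord0).
have [w [w0 w1 wmin wp]] := combF _ (Fp ord0).
have [m0 P0 X0] : exists2 m0, P@_m0 != 0 & X xi m0 = c0.
  apply: contrapT => no; have : \sum_(m <- msupp P) w m = 0.
    rewrite big_seq big1 // => m; rewrite mcoeff_msupp => nz.
    by apply/eqP/negPn/negP => wm; apply: no; exists m => //; exact: wmin.
  by rewrite w1 => /eqP; rewrite oner_eq0.
(* If [m0] were the only exponent of minimal value, every point of [E] would equal it, against
   dimension at least 1. *)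
have [m1 [P1 X1 ne01]] : exists m1, [/\ P@_m1 != 0, X xi m1 = c0 & m0 != m1].
  apply: contrapT => no.
  have pE t : p t = mvec Rr m0.
    have [u [u0 u1 umin up]] := combF _ (Fp t).
    apply/rowP => i; rewrite up -[RHS]mul1r -u1 mulr_suml !big_seq.
    apply: eq_bigr => m; rewrite mcoeff_msupp => nz.
    have [->|um] := eqVneq (u m) 0; first by rewrite !mul0r.
    have [->//|ne] := eqVneq m0 m; case: no; exists m; split=> //; exact: umin.
  move: p_free; rewrite -row_leq_rank [X in \rank X](_ : _ = 0) ?mxrank0 //.
  by apply/row_matrixP => i; rewrite rowK row0 !pE subrr.
have inE m : P@_m != 0 -> X xi m = c0 -> E (mvec Rr m).
  move=> nz Xm; apply/EP; split; first exact: newton_monomial.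
  by move=> b Nb; rewrite -/(X xi m) Xm; case: (Fp ord0) => _; apply.
have line m : P@_m != 0 -> X xi m = c0 -> same_line m0 m1 m.
  move=> nz Xm; apply: minor_same_line => i j; apply/eqP; apply: contraT => ne.
  by case: ndE2; apply: dim_ge2_minor ne; apply: inE.
exists xi, m0, m1; split=> //.
- by rewrite X0 X1.
- by move=> m nz; rewrite X0; split; [exact: minS | exact: line].
(* Otherwise tilt [xi] by [v] until a first new exponent becomes minimal: the
   resulting compact face contains [E] and has dimension at least 2. *)
move=> v v01 m2 P2; rewrite leqNgt; apply/negP => lt2.
pose W m : Rr := (wt v m)%:R.
(* The amount of tilting at which [m] takes the same value as [m0]; the exponent with least [r] is
   met first. *)
pose r m := (X xi m - c0) / (W m0 - W m).
have [m3 C3 min3] := seq_argmin r (s := [seq m <- msupp P | (wt v m < wt v m0)%N]) (i0 := m2)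
  ltac:(by rewrite mem_filter lt2 mcoeff_msupp).
move: C3; rewrite mem_filter mcoeff_msupp => /andP[lt3 P3].
have W_lt m : (wt v m < wt v m0)%N -> 0 < W m0 - W m by rewrite subr_gt0 ltr_nat.
have r_ge0 : 0 <= r m3 by rewrite divr_ge0 ?subr_ge0 ?minS // -subr_ge0 ltW ?W_lt.
pose xi' := xi + r m3 *: (\row_i ((v i)%:R : Rr)).
have xi'E m : dotp xi' (mvec Rr m) = X xi m + r m3 * W m.
  by rewrite dotpDl dotpZl dotp_wt.
have xi'0 i : 0 < xi' ord0 i.
  by rewrite !mxE ltr_pwDl // mulr_ge0.
have min' m : P@_m != 0 -> c0 + r m3 * W m0 <= dotp xi' (mvec Rr m).
  move=> nz; rewrite xi'E; have [lt|le] := ltnP (wt v m) (wt v m0).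
    have : r m3 <= r m by apply: min3; rewrite mem_filter lt mcoeff_msupp.
    by rewrite {2}/r ler_pdivlMr ?W_lt //; lra.
  by rewrite lerD ?minS // ler_wpM2l // ler_nat.
have eq0 : dotp xi' (mvec Rr m0) = c0 + r m3 * W m0 by rewrite xi'E X0.
have eq1 : dotp xi' (mvec Rr m1) = c0 + r m3 * W m0 by rewrite xi'E X1 /W v01.
have eq3 : dotp xi' (mvec Rr m3) = c0 + r m3 * W m0.
  rewrite xi'E; have : r m3 * (W m0 - W m3) = X xi m3 - c0.
    by rewrite /r divfK // gt_eqF // W_lt.
  by lra.
have min'N q : newton P q -> c0 + r m3 * W m0 <= dotp xi' q.
  by apply: newton_dotp => // i; exact: ltW.
have inF m : P@_m != 0 -> dotp xi' (mvec Rr m) = c0 + r m3 * W m0 ->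
    face_at (newton P) xi' (mvec Rr m).
  by move=> nz e; split; [exact: newton_monomial | move=> b /min'N; rewrite e].
apply: (loose (face_at (newton P) xi')).
- by exists xi'; split=> // i; exact: ltW.
- by apply: compact_face => //; exists m0.
- suff [i [j ne]] : exists i j,
      (mvec Rr m1 - mvec Rr m0) ord0 i * (mvec Rr m3 - mvec Rr m0) ord0 j !=
      (mvec Rr m1 - mvec Rr m0) ord0 j * (mvec Rr m3 - mvec Rr m0) ord0 i.
    by apply: dim_ge2_minor ne; apply: inF.
  apply: contrapT => no; have sl : same_line m0 m1 m3.
    apply: minor_same_line => i j; apply/eqP; apply: contraT => ne.
    by case: no; exists i, j.
  by have e := same_line_wt ne01 sl v01; rewrite e ltnn in lt3.
(* Points of [E] are combinations of exponents on its line, on which [v] is constant, so they stay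
   minimal after tilting. *)
- move=> q /EP Fq; have [Nq _] := Fq; have [u [u0 u1 umin uq]] := combF _ Fq.
  split=> // b /min'N; apply: le_trans; rewrite -eq0.
  have -> : q = \sum_(m <- msupp P) u m *: mvec Rr m.
    by apply/rowP => i; rewrite uq summxE; apply: eq_bigr => m _; rewrite [RHS]mxE.
  have dsum (s : seq 'X_{1..n}) : dotp xi' (\sum_(m <- s) u m *: mvec Rr m) =
      \sum_(m <- s) u m * dotp xi' (mvec Rr m).
    elim: s => [|m s IHs]; last by rewrite !big_cons dotpD dotpZ IHs.
    by rewrite !big_nil /dotp big1 // => i _; rewrite [X in _ * X]mxE mulr0.
  rewrite dsum -[X in _ <= X]mul1r -u1 mulr_suml !big_seq ler_sum // => m.
  rewrite mcoeff_msupp => nz; have [->|um] := eqVneq (u m) 0; first by rewrite !mul0r.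
  have Xm := umin m nz um; rewrite ler_wpM2l // eq0 xi'E Xm.
  by rewrite /W (same_line_wt ne01 (line m nz Xm) v01).
Qed.

End LooseEdge.

(** * Completions *)

Section Spans.
Variable R : comUnitRingType.
Implicit Types (I T : R -> Prop).

Lemma ideal_span_sub T T' : (forall y, T y -> T' y) -> T' 0 ->
  (forall y z, T' y -> T' z -> T' (y + z)) -> (forall c y, T' y -> T' (c * y)) ->
  forall y, Defs.span T y -> T' y.
Proof.
move=> TT' T0 TD TM y [k [r [s [Ts ->]]]].
by apply: big_ind => // i _; apply: TM; apply: TT'.
Qed.

Lemma ideal_span_gen T y : T y -> Defs.span T y.
Proof. by move=> Ty; exists 1%N, (fun=> 1), (fun=> y); rewrite big_ord1 mul1r. Qed.

Lemma ideal_span0 T : Defs.span T 0.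
Proof. by exists 0%N, (fun=> 0), (fun=> 0); rewrite big_ord0; split=> // -[]. Qed.

Lemma ideal_spanM T c y : Defs.span T y -> Defs.span T (c * y).
Proof.
move=> [k [r [s [Ts ->]]]]; exists k, (fun i => c * r i), s; split=> //.
by rewrite mulr_sumr; apply: eq_bigr => i _; rewrite mulrA.
Qed.

Lemma ideal_spanD T y z : Defs.span T y -> Defs.span T z -> Defs.span T (y + z).
Proof.
move=> [k [r [s [Ts ->]]]] [l [r' [s' [Ts' ->]]]].
exists (k + l)%N, (fun i => match split i with inl j => r j | inr j => r' j end),
  (fun i => match split i with inl j => s j | inr j => s' j end); split.
  by move=> i; case: (split i).
rewrite big_split_ord; congr (_ + _); apply: eq_bigr => i _.
  by rewrite (unsplitK (inl i)).
by rewrite (unsplitK (inr i)).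
Qed.

Lemma pow_ideal0 I y : pow_ideal I 0 y.
Proof.
rewrite -[y]mulr1; apply: ideal_spanM; apply: ideal_span_gen.
by exists (fun=> 0); rewrite big_ord0; split=> // -[].
Qed.

Lemma pow_idealS I k t y : I t -> pow_ideal I k y -> pow_ideal I k.+1 (t * y).
Proof.
move=> It; move: y; apply: ideal_span_sub; rewrite ?mulr0; last first.
- by move=> c y; rewrite mulrCA; apply: ideal_spanM.
- by move=> y z; rewrite mulrDr; apply: ideal_spanD.
- exact: ideal_span0.
move=> _ [s [Is ->]]; apply: ideal_span_gen.
exists (fun j => if unlift ord0 j is Some j' then s j' else t); split.
  by move=> j; case: (unlift ord0 j).
rewrite big_ord_recl unlift_none; congr (_ * _).
by apply: eq_bigr => j _; rewrite liftK.
Qed.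

End Spans.

Section PowersOfMaximalIdeal.
Variables (S : comUnitRingType) (n : nat) (x : 'I_n -> S) (I : S -> Prop).

Lemma pow_ideal_deg_ge k y : (forall z, I z -> deg_ge x 1 z) -> pow_ideal I k y -> deg_ge x k y.
Proof.
move=> I1; move: y; apply: ideal_span_sub; last first.
- by move=> c y; apply: mono_spanZ.
- exact: mono_spanD.
- exact: mono_span0.
move=> _ [s [Is ->]]; elim: k s Is => [|k IHk] s Is.
  by rewrite big_ord0 -(meval1 x); apply: mono_span_eval.
rewrite big_ord_recl; apply: (mono_spanM _ (I1 _ (Is ord0)) (IHk _ _)) => // m1 m2 h1 h2.
by rewrite mdegD -add1n leq_add.
Qed.

Lemma deg_ge_pow_ideal k y : (forall i, I (x i)) -> deg_ge x k y -> pow_ideal I k y.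
Proof.
move=> Ix [Q sQ ->]; rewrite [Q in Q.@[x]]mpolyE (raddf_sum (meval x)) big_seq /=.
apply: big_ind => [|y' z|m]; [exact: ideal_span0 | exact: ideal_spanD |].
rewrite mcoeff_msupp => /sQ; rewrite mevalZ => le; apply: ideal_spanM; clear sQ.
elim: k m le => [|k IHk] m le; first exact: pow_ideal0.
have [i mi] : exists i, m i != 0%N.
  apply: contrapT => no; move: le; rewrite mdegE big1 // => i _.
  by apply/eqP/negPn/negP => mi; apply: no; exists i.
have mE : m = (U_(i) + (m - U_(i)))%MM by rewrite addmC submK // lep1mP.
rewrite mE mpolyXD mevalM mevalXU; apply: pow_idealS => //; apply: IHk.
by move: le; rewrite {1}mE mdegD mdeg1 add1n ltnS.
Qed.

End PowersOfMaximalIdeal.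

Section Completion.
Variables (R : comUnitRingType) (n : nat) (x : 'I_n -> R) (K : fieldType).
Variables (pi : {rmorphism R -> K}) (S : comUnitRingType) (iota : {rmorphism R -> S}).
Variable pih : {rmorphism S -> K}.
Hypothesis gen : same_set (@maxid R) (Defs.span (fun z => exists i, z = x i)).
Hypothesis res : residue_map pi.
Hypothesis compl : is_completion iota.
Hypothesis pihE : forall r, pih (iota r) = pi r.
Let xh i := iota (x i).
Let mh := Defs.span (fun z => exists r, maxid r /\ z = iota r).

Lemma maxid_gen i : maxid (x i).
Proof. by apply/gen; apply: ideal_span_gen; exists i. Qed.

Lemma completion_maxid_deg1 y : mh y -> deg_ge xh 1 y.
Proof.
move: y; apply: ideal_span_sub; last first.
- by move=> c y; apply: mono_spanZ.
- exact: mono_spanD.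
- exact: mono_span0.
move=> _ [r [/gen [k [a [s [sx ->]]]] ->]].
rewrite rmorph_sum; apply: mono_span_sum => i; rewrite rmorphM; apply: mono_spanZ.
have [j ->] := sx i; rewrite -/(xh j) -(mevalXU xh); apply: mono_span_eval.
by apply: supp_inX; rewrite mdeg1.
Qed.

(** Since the [x i] generate the maximal ideal, the topology of the completion is that of degrees in
    [xh]; this translates the axioms of a completion into the hypotheses of the lifting. *)
Lemma completion_powE k y : pow_ideal mh k y <-> deg_ge xh k y.
Proof.
split; first by apply: pow_ideal_deg_ge; exact: completion_maxid_deg1.
apply: deg_ge_pow_ideal => i; apply: ideal_span_gen.
by exists (x i); split=> //; exact: maxid_gen.
Qed.

Lemma completion_surj c : exists y, pih y = c.
Proof. by have [r <-] := res.1 c; exists (iota r). Qed.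

Lemma completion_pi_gen i : pih (xh i) = 0.
Proof. by rewrite pihE; apply/res.2; exact: maxid_gen. Qed.

Lemma completion_separated y : (forall k, deg_ge xh k y) -> y = 0.
Proof. by have [_ _ sep _] := compl => yk; apply: sep => k; apply/completion_powE. Qed.

Lemma completion_complete (u : nat -> S) : (forall k, deg_ge xh k (u k.+1 - u k)) ->
  exists y, forall k, deg_ge xh k (y - u k).
Proof.
have [_ _ _ cpl] := compl => uk.
have [|y yP] := cpl u; first by move=> k; apply/completion_powE.
by exists y => k; apply/completion_powE.
Qed.

Lemma completion_approx y : exists r, deg_ge xh 1 (y - iota r).
Proof. by have [app _ _ _] := compl; have [r rP] := app 1%N y; exists r; apply/completion_powE. Qed.

Lemma completion_deg1_pi0 y : deg_ge xh 1 y -> pih y = 0.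
Proof. by apply: pi_deg_ge1; exact: completion_pi_gen. Qed.

Lemma completion_ker y : pih y = 0 -> deg_ge xh 1 y.
Proof.
move=> y0; have [r yr] := completion_approx y.
have : pi r = 0.
  by have := completion_deg1_pi0 yr;
    rewrite rmorphB /= pihE y0 sub0r => /eqP; rewrite oppr_eq0 => /eqP.
move=> /res.2 rm; rewrite -(subrK (iota r) y); apply: mono_spanD yr _.
by apply: completion_maxid_deg1; apply: ideal_span_gen; exists r.
Qed.

(** The geometric series in [z] converges to the inverse. *)
Lemma completion_one_sub z : deg_ge xh 1 z -> (1 - z) \is a GRing.unit.
Proof.
move=> z1.
have zk k : deg_ge xh k (z ^+ k).
  elim: k => [|k IHk]; first by rewrite expr0 -(meval1 xh); apply: mono_span_eval.
  rewrite exprS; apply: (mono_spanM _ z1 IHk) => m1 m2 h1 h2.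
  by rewrite mdegD -add1n leq_add.
have [|y yP] := completion_complete (u := fun k => \sum_(i < k) z ^+ i).
  by move=> k; rewrite big_ord_recr /= addrAC subrr add0r.
apply/unitrP; exists y; have e : (1 - z) * y = 1; last by rewrite mulrC.
apply/eqP; rewrite -subr_eq0; apply/eqP; apply: completion_separated => k.
have -> : (1 - z) * y - 1 = (1 - z) * (y - \sum_(i < k) z ^+ i) - z ^+ k.
  have := subrX1 z k; rewrite mulrBr => e.
  have -> : (1 - z) * (\sum_(i < k) z ^+ i) = 1 - z ^+ k.
    by rewrite -opprB mulNr -e opprB.
  by ring.
by apply: mono_spanB; [apply: mono_spanZ; exact: yP | exact: zk].
Qed.

(** Invertibility comes from [R]: [y] is approximated by some [iota r] with [r] a unit, and the
    quotient [y / iota r] is 1 up to an element of degree at least 1. *)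
Lemma completion_unit y : pih y != 0 -> y \is a GRing.unit.
Proof.
move=> y0; have [r yr] := completion_approx y.
have r0 : pi r != 0.
  apply: contraNneq y0 => r0; have := completion_deg1_pi0 yr.
  by rewrite rmorphB /= pihE r0 subr0 => ->.
have ru : r \is a GRing.unit.
  by apply: contraT => nu; case/eqP: r0; apply/res.2.
have iu : iota r \is a GRing.unit by rewrite rmorph_unit.
have -> : y = iota r * (1 - (- ((iota r)^-1 * (y - iota r)))).
  by rewrite opprK mulrDr mulr1 mulVKr // addrC subrK.
rewrite unitrMl ?completion_one_sub //.
by apply: mono_spanN; apply: mono_spanZ.
Qed.

End Completion.

(** * The factorization *)

Lemma dotp_multiple (Rr : realType) n (xi : 'rV[Rr]_n) (m m' : 'X_{1..n})
    (d : 'I_n -> int) (q : int) :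
  (forall i, (m' i)%:Z - (m i)%:Z = q * d i) ->
  dotp xi (mvec Rr m') - dotp xi (mvec Rr m) = q%:~R * \sum_i xi ord0 i * (d i)%:~R.
Proof.
move=> md; rewrite /dotp -sumrB mulr_sumr; apply: eq_bigr => i _.
rewrite !mxE -mulrBr [X in _ * X = _](_ : _ = (q * d i)%:~R); last by rewrite -md intrB.
by rewrite intrM mulrCA.
Qed.

(* The primitive direction [cp - cm] has coordinates of both signs because the
   positive functional [xi] vanishes on it. *)
Lemma loose_edge_direction (Rr : realType) n (S : comRingType) (P : {mpoly S[n]})
    (E : 'rV[Rr]_n -> Prop) : loose_edge (newton P) E ->
  exists (xi : 'rV[Rr]_n) (cp cm m0 : 'X_{1..n}),
  [/\ [/\ forall i, cp i = 0%N \/ cm i = 0%N,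
          exists i, (0 < cp i)%N,
          exists i, (0 < cm i)%N &
          forall m m', bal_eq cp cm m m' -> exists j,
            lattice_line cp cm m m' j \/ lattice_line cp cm m' m j],
      [/\ forall i, 0 < xi ord0 i,
          forall p, E p <-> face_at (newton P) xi p &
          dotp xi (mvec Rr cp) = dotp xi (mvec Rr cm)],
      P@_m0 != 0 &
      forall m, P@_m != 0 -> [/\ bal_le cp cm m0 m,
        dotp xi (mvec Rr m0) <= dotp xi (mvec Rr m) &
        dotp xi (mvec Rr m) = dotp xi (mvec Rr m0) -> bal_eq cp cm m0 m]].
Proof.
move=> /loose_edge_structure [xi [m0 [m1 [xi0 EP [P0 ne01 X01] minX minW]]]].
have [cp [cm [disj dc [i0 ci0] prim]]] := direction_exists ne01.
have [q0 q0P] := prim _ dc.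
have q0_neq0 : q0 != 0.
  apply: contraNneq ne01 => e; apply/eqP/mnmP => i.
  by have := q0P i; rewrite e mul0r; lia.
have bal_xi : dotp xi (mvec Rr cp) = dotp xi (mvec Rr cm).
  have e0 := dotp_multiple xi q0P; rewrite -X01 subrr in e0.
  have c1 i : (cp i)%:Z - (cm i)%:Z = 1 * ((cp i)%:Z - (cm i)%:Z) by rewrite mul1r.
  apply/eqP; rewrite -subr_eq0 (dotp_multiple xi c1) mul1r.
  by move/esym/eqP: e0; rewrite mulf_eq0 intr_eq0 (negbTE q0_neq0).
have wbal w : wt w cp = wt w cm -> wt w m0 = wt w m1.
  move=> bal; apply/esym/eqP; rewrite -eqz_nat -subr_eq0 wt_subz.
  under eq_bigr do rewrite q0P mulrCA.
  by rewrite -mulr_sumr -wt_subz bal subrr mulr0.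
have pos (m : 'X_{1..n}) : (0 < dotp xi (mvec Rr m)) <-> exists i, (0 < m i)%N.
  have ge0 i : 0 <= xi ord0 i * mvec Rr m ord0 i by rewrite mulr_ge0 ?mxE ?ler0n // ltW.
  split=> [gt0|[i mi]].
    apply: contrapT => no; move: gt0; rewrite /dotp big1 ?ltxx // => i _.
    rewrite mxE (_ : m i = 0%N) ?mulr0 //; apply/eqP; rewrite -leqn0 leqNgt.
    by apply/negP => mi; apply: no; exists i.
  rewrite /dotp (bigD1 i) //= ltr_pwDl ?sumr_ge0 // mulr_gt0 // mxE ltr0n //.
have [cp0 cm0] : (exists i, (0 < cp i)%N) /\ (exists i, (0 < cm i)%N).
  have [cpi|cpi] := posnP (cp i0).
    have cm0 : exists i, (0 < cm i)%N by exists i0; move: ci0; rewrite cpi lt0n eq_sym.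
    by split=> //; apply/pos; rewrite bal_xi; apply/pos.
  have cp0 : exists i, (0 < cp i)%N by exists i0.
  by split=> //; apply/pos; rewrite -bal_xi; apply/pos.
exists xi, cp, cm, m0; split=> //.
  split=> // m m' /(bal_eq_collinear disj cp0 cm0)/prim[q qP].
  exists (absz q); have [q_ge0|q_lt0] := leP 0 q; [left | right];
    apply/mnmP => i; rewrite !mnmDE !mulmnE; have := qP i; nia.
move=> m nz; have [le line] := minX m nz; split=> //.
  by move=> w /wbal /minW; apply.
by move=> /line sl w /wbal e; rewrite (same_line_wt ne01 sl e).
Qed.

Lemma bal_eq_lattice n (cp cm : 'X_{1..n}) (Rr : realType) (xi : 'rV[Rr]_n) m m' j :
  dotp xi (mvec Rr cp) = dotp xi (mvec Rr cm) -> lattice_line cp cm m m' j ->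
  dotp xi (mvec Rr m') = dotp xi (mvec Rr m).
Proof.
move=> bal /(congr1 (fun q => dotp xi (mvec Rr q))).
by rewrite !mvecD !mvecMn !dotpD !dotpZ bal => /addIr.
Qed.

Lemma mcoeff_sym_restr (Rr : realType) n (R : comUnitRingType) (K : fieldType)
    (pi : {rmorphism R -> K}) (P : {mpoly R[n]}) (A : 'rV[Rr]_n -> Prop) m :
  (sym_restr pi P A)@_m = if `[< A (mvec Rr m) >] then pi P@_m else 0.
Proof.
rewrite /sym_restr (mcoeff_sumX (fun m => `[< A (mvec Rr m) >]) (fun m => pi P@_m)) ?msupp_uniq //.
by rewrite mcoeff_msupp; case: (eqVneq P@_m 0) => [->|] //=; rewrite rmorph0 if_same.
Qed.

(** Homogeneity for each balanced weight passes from the product to the factors, so both are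
    supported on lines. A nontrivial monomial factor of [G] would make it divisible by a variable,
    hence only [H] keeps one. *)
Lemma coprime_factors_shape n (K : fieldType) (cp cm : 'X_{1..n}) (G H : {mpoly K[n]}) :
  (forall i, cp i = 0%N \/ cm i = 0%N) -> (exists i, (0 < cp i)%N) ->
  (forall m m', bal_eq cp cm m m' -> exists j,
     lattice_line cp cm m m' j \/ lattice_line cp cm m' m j) ->
  G * H != 0 ->
  (forall m m', (G * H)@_m != 0 -> (G * H)@_m' != 0 -> bal_eq cp cm m m') ->
  rel_prime G H -> (forall i, ~ mdvd 'X_i G) ->
  exists e k1 k2 (g h : {poly K}),
    [/\ size g = k1.+1, size h = k2.+1, g`_0 != 0, h`_0 != 0 &
    [/\ coprimep g h, G = hform cp cm k1 g & H = 'X_[e] * hform cp cm k2 h]].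
Proof.
move=> disj cp0 prim GH0 lineGH rp nvar.
have [G0 H0] : G != 0 /\ H != 0 by move: GH0; rewrite mulf_eq0 negb_or => /andP.
have lineF (U V : {mpoly K[n]}) : U * V = G * H -> U != 0 -> V != 0 ->
    forall m m', U@_m != 0 -> U@_m' != 0 -> bal_eq cp cm m m'.
  move=> UV U0 V0 m m' Um Um' w bal.
  have [N NP] : exists N, forall q, (U * V)@_q != 0 -> wt w q = N.
    exists (wt w (mlead (G * H))) => q; rewrite UV => nz; apply: lineGH => //.
    by rewrite mleadc_eq0.
  by have [N1 N1P] := homogeneous_factor U0 V0 NP; rewrite !N1P.
have [e1 [k1 [g [sg g0 GE]]]] := line_polynomial disj cp0 prim G0 (lineF _ _ (erefl _) G0 H0).
have [e [k2 [h [sh h0 HE]]]] := line_polynomial disj cp0 prim H0 (lineF _ _ (mulrC _ _) H0 G0).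
have e10 : e1 = 0%MM.
  apply/mnmP => i; rewrite mnm0E; apply/eqP; apply: contraT; rewrite -lt0n => e1i.
  case: (nvar i); apply: dvd_var; rewrite GE.
  apply: (supp_inM (T1 := eq e1) (T2 := fun _ => True)) => //; last exact: supp_inX.
  by move=> _ m2 <- _; rewrite mnmDE ltn_addr.
rewrite e10 mpolyX0 mul1r in GE.
exists e, k1, k2, g, h; split=> //; split=> //.
by apply: (hform_coprime disj cp0 (e := e) sg sh); rewrite -GE -HE.
Qed.

Lemma hmono_top n (cp cm : 'X_{1..n}) k : hmono cp cm k k = (cp *+ k)%MM.
Proof. by apply/mnmP => i; rewrite hmonoE subnn muln0 addn0 mulmnE. Qed.

Lemma rmorph_meval (R S : comRingType) n (f : {rmorphism R -> S})
    (x : 'I_n -> R) (P : {mpoly R[n]}) :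
  f P.@[x] = (map_mpoly f P).@[fun i => f (x i)].
Proof.
rewrite [P in LHS]mpolyE [P in RHS]mpolyE (raddf_sum (meval x)) (raddf_sum f).
rewrite (raddf_sum (map_mpoly f)) (raddf_sum (meval _)); apply: eq_bigr => m _ /=.
rewrite map_mpolyZ map_mpolyX !mevalZ !mevalX rmorphM rmorph_prod.
by congr (_ * _); apply: eq_bigr => i _; rewrite rmorphXn.
Qed.

(** * The face of a factor cut out by the weight *)

Section FactorFace.
Variables (Rr : realType) (n : nat) (K : fieldType) (cp cm e : 'X_{1..n}) (k : nat).
Variables (p : {poly K}) (S : comUnitRingType) (pi : {rmorphism S -> K}).
Variables (w : 'I_n -> nat) (a : 'X_{1..n} -> S) (Q : {mpoly S[n]}).
Hypothesis disj : forall i, cp i = 0%N \/ cm i = 0%N.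
Hypothesis cp_neq0 : exists i, (0 < cp i)%N.
Hypotheses (sp : size p = k.+1) (p0 : p`_0 != 0).
Hypotheses (w_gt0 : forall i, (0 < w i)%N) (bal : wt w cp = wt w cm).
Let Q0 := 'X_[e] * hform cp cm k p.
Let N := wt w (e + cm *+ k)%MM.
Hypothesis a_min : forall m, a m != 0 -> pi (a m) != 0 /\ (N <= wt w m)%N.
Hypothesis a_init : forall m, wt w m = N -> pi (a m) = Q0@_m.
Hypothesis Qa : forall m, Q@_m != 0 -> a m != 0.
Hypothesis Qmin : forall m, a m != 0 ->
  (forall m', a m' != 0 -> (m' <= m)%MM -> m' = m) -> pi Q@_m = pi (a m).
Let xi : 'rV[Rr]_n := \row_i (w i)%:R.

Lemma supp_shape : supp_in (fun m => exists2 j, (j <= k)%N & m = (e + hmono cp cm k j)%MM) Q0.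
Proof.
apply: (supp_inM (T1 := eq e)); [|exact: supp_inX|exact: supp_hform].
by move=> _ _ <- [j [jk -> _]]; exists j.
Qed.

(** Any support exponent properly below [m] would have weight less than [N], as [w] is positive. So
    a support exponent of weight [N] is minimal, and the finite expansion preserves its residue. *)
Lemma factor_init m : wt w m = N -> pi Q@_m = Q0@_m.
Proof.
move=> wm; have [nz|z] := boolP (a m != 0).
  rewrite Qmin ?a_init // => m' nz' le; apply: wt_inj_le w_gt0 le _.
  by rewrite wm; case: (a_min nz').
rewrite -a_init //; move: z; rewrite negbK => /eqP az; rewrite az.
congr (pi _); apply/eqP; apply: contraT => /Qa; by rewrite az eqxx.
Qed.

Lemma factor_segment q : face_at (newton Q) xi q <-> exists2 s, 0 <= s <= k%:R &
    q = mvec Rr e + s *: mvec Rr cp + (k%:R - s) *: mvec Rr cm.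
Proof.
have coefQ0 j : (j <= k)%N -> Q0@_(e + hmono cp cm k j) = p`_j.
  by move=> jk; rewrite mcoeffXM coef_hform.
have nzQ m : wt w m = N -> Q0@_m != 0 -> Q@_m != 0.
  by move=> wm; rewrite -factor_init //; apply: contraNneq => ->; rewrite rmorph0.
apply: face_segment => [i||m nz|m nz||].
- by rewrite mxE ltr0n.
- by rewrite !dotp_wt bal.
- by rewrite !dotp_wt ler_nat; case: (a_min (Qa nz)).
- rewrite !dotp_wt => /eqP; rewrite eqr_nat => /eqP wm; apply: supp_shape.
  by rewrite -a_init //; case: (a_min (Qa nz)).
- by apply: nzQ => //; rewrite -(hmono0 cp) coefQ0.
- apply: nzQ; first by rewrite /N !wtD !wtMn bal.
  by rewrite -(hmono_top cp cm) coefQ0 // -[k]/(k.+1.-1) -sp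
     -/(lead_coef p) lead_coef_eq0 -size_poly_gt0 sp.
Qed.

Lemma factor_init_neq0 : Q@_(e + cm *+ k) != 0.
Proof.
have := factor_init (erefl N).
rewrite -{2}(hmono0 cp) mcoeffXM coef_hform // => e0.
by apply: contraNneq p0 => z; rewrite -e0 z rmorph0.
Qed.

Lemma factor_restr : sym_restr pi Q (face_at (newton Q) xi) = Q0.
Proof.
have nz1 := factor_init_neq0.
have xi0 i : 0 <= xi ord0 i by rewrite mxE ler0n.
apply/mpolyP => m; rewrite mcoeff_sym_restr; case: ifPn => [/asboolP[Nm minm]|/asboolP nF].
  apply: factor_init; have := minm _ (newton_monomial Rr nz1).
  rewrite !dotp_wt ler_nat => le1.
  have : N%:R <= dotp xi (mvec Rr m).
    by apply: newton_dotp Nm => // q /Qa /a_min[_]; rewrite dotp_wt ler_nat.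
  by rewrite dotp_wt ler_nat => le2; apply/eqP; rewrite eqn_leq le1.
apply/esym/eqP; apply: contraT => nz; case: nF.
have wm : wt w m = N.
  have [j jk ->] := supp_shape nz; rewrite /N !wtD wtMn wt_hmono //.
have nzQ : Q@_m != 0 by apply: contraNneq nz => z; rewrite -factor_init // z rmorph0.
split=> [|b]; first exact: newton_monomial.
rewrite dotp_wt wm; apply: newton_dotp => // q /Qa /a_min[_].
by rewrite dotp_wt ler_nat.
Qed.

End FactorFace.

Theorem theorem1p1 (R : comUnitRingType) (n : nat) (x : 'I_n -> R)
    (K : fieldType) (pi : {rmorphism R -> K})
    (Rhat : comUnitRingType) (iota : {rmorphism R -> Rhat})
    (pih : {rmorphism Rhat -> K}) (Rr : realType)
    (f : R) (P : {mpoly R[n]}) (E : 'rV[Rr]_n -> Prop) (G H : {mpoly K[n]}) :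
  regular_local_ring R -> reg_sys_params x ->
  residue_map pi -> is_completion iota -> (forall r, pih (iota r) = pi r) ->
  f != 0 -> unit_expansion x P f ->
  loose_edge (newton P) E ->
  sym_restr pi P E = G * H -> rel_prime G H ->
  (forall i : 'I_n, ~ mdvd 'X_i G) ->
  exists (g h : Rhat) (Pg Ph : {mpoly Rhat[n]}) (E1 E2 : 'rV[Rr]_n -> Prop),
    [/\ iota f = g * h,
        unit_expansion (fun i => iota (x i)) Pg g,
        unit_expansion (fun i => iota (x i)) Ph h,
        is_face (newton Pg) E1 /\ compact_pts E1 &
        is_face (newton Ph) E2 /\ compact_pts E2] /\
    [/\ minkowski_eq E E1 E2, sym_restr pih Pg E1 = G & sym_restr pih Ph E2 = H].
Proof.
move=> _ [_ gen] res compl pihE _ [unitP fE] edge GHE rp nvar.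
have [xi [cp [cm [m0 [[disj cp0 cm0 prim] [xi0 EP bal_xi] P0 minP]]]]] :=
  loose_edge_direction edge.
have piP m : P@_m != 0 -> pi P@_m != 0.
  move=> nz; case: (unitP m) => [u|e]; last by rewrite e eqxx in nz.
  by apply/eqP => /res.2; rewrite /maxid u.
have inE m : P@_m != 0 -> E (mvec Rr m) <-> dotp xi (mvec Rr m) = dotp xi (mvec Rr m0).
  move=> nz; split=> [/EP[_ minm]|e].
    have [_ le _] := minP m nz; apply/eqP; rewrite eq_le le andbT.
    exact: minm (newton_monomial Rr P0).
  apply/EP; split=> [|b Nb]; first exact: newton_monomial.
  by rewrite e; apply: newton_dotp Nb => [i|q /minP[]//]; exact: ltW.
have nzGH m : (G * H)@_m != 0 <-> P@_m != 0 /\ dotp xi (mvec Rr m) = dotp xi (mvec Rr m0).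
  rewrite -GHE mcoeff_sym_restr; case: ifPn => [/asboolP Em|/asboolP nEm].
    split=> [nz|[/piP//]].
    have nz' : P@_m != 0 by apply: contraNneq nz => ->; rewrite rmorph0.
    by split=> //; apply/inE.
  by rewrite eqxx; split=> // -[nz /(inE m nz)].
have lineGH m : (G * H)@_m != 0 -> bal_eq cp cm m0 m by move=> /nzGH[/minP[_ _]].
have GH0 : G * H != 0.
  have : (G * H)@_m0 != 0 by apply/nzGH.
  by apply: contraNneq => ->; rewrite mcoeff0.
have [e [k1 [k2 [g [h [[sg sh g0 h0] [gh GE HE]]]]]]] : exists e k1 k2 (g h : {poly K}),
    [/\ size g = k1.+1, size h = k2.+1, g`_0 != 0, h`_0 != 0 &
    [/\ coprimep g h, G = hform cp cm k1 g & H = 'X_[e] * hform cp cm k2 h]].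
  apply: coprime_factors_shape => // m m' /lineGH e1 /lineGH e2 w bal.
  by rewrite -e1 // -e2.
pose k := (k1 + k2)%N; pose a := (e + cm *+ k)%MM.
have coefGH j : (j <= k)%N -> (G * H)@_(e + hmono cp cm k j) = (g * h)`_j.
  move=> jk; rewrite GE HE mulrCA -hformM ?sg ?sh //.
  by rewrite mcoeffXM coef_hform.
have GHa : (G * H)@_a != 0.
  by rewrite /a -(hmono0 cp) coefGH // coef0M mulf_neq0.
have GHb : (G * H)@_(e + cp *+ k) != 0.
  have gh0 : g * h != 0 by rewrite mulf_neq0 // -size_poly_gt0 ?sg ?sh.
  rewrite -(hmono_top cp cm) coefGH // (_ : k = (size (g * h)).-1)
    -?/(lead_coef _) ?lead_coef_eq0 //.
  by rewrite size_mul -?size_poly_gt0 ?sg ?sh // addSn addnS.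
have suppGH m : (G * H)@_m != 0 -> exists2 j, (j <= k)%N & m = (e + hmono cp cm k j)%MM.
  rewrite GE HE mulrCA -hformM ?sg ?sh //; exact: supp_shape.
have [[Pa xia] [Pb _]] := ((nzGH _).1 GHa, (nzGH _).1 GHb).
have aS m : P@_m != 0 -> bal_le cp cm a m.
  by move=> /minP[le _ _] w bal; rewrite -(lineGH a GHa w bal); apply: le.
(* The edge is cut out by the real functional [xi], whereas lifting and the faces of the factors use
   the integral [w]. Both are constant along [cp - cm], which lets the resulting segments be
   compared. *)
have [w w_gt0 wbal] := positive_balanced_weight disj cp0 cm0.
(* The summand 0 gives [a1] the common shape [e + cm *+ k] of the factors, with [e = 0] for [G]. *)
pose a1 := (0 + cm *+ k1)%MM; pose a2 := (e + cm *+ k2)%MM.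
have a12 v : wt v a = (wt v a1 + wt v a2)%N.
  by rewrite /a /a1 /a2 !wtD !wtMn wt0 /k mulnDr; lia.
pose xh i := iota (x i).
have ker := completion_ker gen res compl pihE.
have sep := completion_separated gen compl.
have cpl := completion_complete gen compl.
have surj := completion_surj res pihE.
have pix := completion_pi_gen gen res pihE.
have unit_h := completion_unit gen res compl pihE.
have suppG : supp_in (fun m => bal_le cp cm a1 m /\ wt w m = wt w a1) G.
  rewrite GE -[hform _ _ _ _]mul1r -mpolyX0 => m /supp_shape[j jk ->].
  have wE v : wt v cp = wt v cm -> wt v (0 + hmono cp cm k1 j)%MM = wt v a1.
    by move=> bal; rewrite !wtD wt_hmono // wtMn.
  by split=> [v /wE ->|] //; exact: wE.
have suppH : supp_in (fun m => bal_le cp cm a2 m /\ wt w m = wt w a2) H.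
  rewrite HE => m /supp_shape[j jk ->].
  have wE v : wt v cp = wt v cm -> wt v (e + hmono cp cm k2 j)%MM = wt v a2.
    by move=> bal; rewrite !wtD wt_hmono // wtMn.
  by split=> [v /wE ->|] //; exact: wE.
have nzP m : (map_mpoly iota P)@_m != 0 -> P@_m != 0.
  by rewrite mcoeff_map_mpoly; apply: contraNneq => ->; apply/eqP; exact: rmorph0.
(* The three supports are the exponents that no balanced weight puts below [a], [a1] and [a2]; they
   are compatible with products because [a] and [a1 + a2] have equal weights. *)
have [|||||||ca [cb [gg [hh [[ga hb fgh] [caP cbP cai cbi]]]]]] :=
  @hensel _ _ pih _ xh surj ker sep cpl w (bal_le cp cm a) (bal_le cp cm a1) (bal_le cp cm a2)
    G H (wt w a1) (wt w a2) (map_mpoly iota P) w_gt0.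
- move=> m m' am v bal; rewrite wtD; apply: leq_trans (am v bal) _; exact: leq_addr.
- by move=> m1 m2 am1 am2 v bal; rewrite a12 wtD leq_add ?am1 ?am2.
- exact: suppG.
- exact: suppH.
- move=> N D ltN sD.
  have [|A [B [DE sA sB]]] := dec_poly (cp := cp) (cm := cm) (e := e) disj sg sh g0 gh (D := D).
    by apply: supp_inW sD => m [].
  exists A, B; split; first by rewrite GE HE.
    apply: supp_inW sA => m' [m nz eqm]; split=> [v bal|].
      have := (sD m nz).1 v bal; rewrite -(eqm v bal) a12 /a1 !wtD wt0; lia.
    by have := eqm w wbal; rewrite (sD m nz).2 /a1 !wtD wt0.
  apply: supp_inW sB => m' [m nz eqm]; split=> [v bal|].
    have := (sD m nz).1 v bal; rewrite -(eqm v bal) a12 /a2 !wtD wt0; lia.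
  by have := eqm w wbal; rewrite (sD m nz).2 /a2 !wtD; lia.
- by move=> m /nzP /aS am; split=> //; rewrite -a12; apply: am.
- move=> m; rewrite -a12 mcoeff_map_mpoly pihE => wm.
  rewrite -GHE mcoeff_sym_restr; have [->|nz] := eqVneq P@_m 0; first by rewrite rmorph0 if_same.
  suff Em : E (mvec Rr m) by rewrite asboolT.
  apply/(inE m nz); rewrite -xia.
  (* Equality for the positive weight [w] forces equality for all balanced weights, so [m] lies on
     the lattice line through [a], where [xi] is constant. *)
  have [j []] := prim _ _ (bal_le_eq w_gt0 wbal (aS m nz) wm).
    exact: bal_eq_lattice.
  by move/(bal_eq_lattice bal_xi) => ->.
have [Pg [ugP Pga Pgm]] := finite_expansion pix unit_h sep cpl ga
  (fun m nz => let: And3 u _ _ := caP m nz in u).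
have [Ph [uhP Phb Phm]] := finite_expansion pix unit_h sep cpl hb
  (fun m nz => let: And3 u _ _ := cbP m nz in u).
pose xiw : 'rV[Rr]_n := \row_i (w i)%:R.
have xiw0 i : 0 < xiw ord0 i by rewrite mxE ltr0n.
have amin m : ca m != 0 -> pih (ca m) != 0 /\ (wt w a1 <= wt w m)%N by move=> /caP[].
have bmin m : cb m != 0 -> pih (cb m) != 0 /\ (wt w a2 <= wt w m)%N by move=> /cbP[].
have GE' : G = 'X_[0] * hform cp cm k1 g by rewrite mpolyX0 mul1r.
have ai m : wt w m = wt w a1 -> pih (ca m) = ('X_[0] * hform cp cm k1 g)@_m.
  by rewrite -GE'; apply: cai.
have bi m : wt w m = wt w a2 -> pih (cb m) = ('X_[e] * hform cp cm k2 h)@_m.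
  by rewrite -HE; apply: cbi.
exists gg, hh, Pg, Ph, (face_at (newton Pg) xiw), (face_at (newton Ph) xiw); split; split=> //.
- by rewrite fE rmorph_meval.
- split; first by exists xiw; split=> // i; exact: ltW.
  apply: compact_face => //; exists a1.
  exact: (factor_init_neq0 disj cp0 g0 w_gt0 amin ai Pga Pgm).
- split; first by exists xiw; split=> // i; exact: ltW.
  apply: compact_face => //; exists a2.
  exact: (factor_init_neq0 disj cp0 h0 w_gt0 bmin bi Phb Phm).
- apply: (@minkowski_segments _ _ (mvec Rr e) (mvec Rr cp) (mvec Rr cm) k1 k2).
  + move=> p; rewrite EP; apply: face_segment => // [m nz|m nz exi].
      by rewrite xia; case: (minP m nz).
    by apply: suppGH; apply/nzGH; rewrite -xia.
  + move=> p; rewrite (factor_segment disj cp0 sg g0 w_gt0 wbal amin ai Pga Pgm).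
    have -> : mvec Rr 0%MM = 0 :> 'rV[Rr]_n by apply/rowP => i; rewrite !mxE mnm0E.
    by split=> -[s sk ->]; exists s; rewrite // add0r.
  + exact: (factor_segment disj cp0 sh h0 w_gt0 wbal bmin bi Phb Phm).
- by rewrite (factor_restr Rr disj cp0 g0 w_gt0 wbal amin ai Pga Pgm) -GE'.
- by rewrite (factor_restr Rr disj cp0 h0 w_gt0 wbal bmin bi Phb Phm) -HE.
Qed.
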